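(* Let $\mathcal{V}$ be a strict symmetric monoidal category and let $H$ be a Hopf algebra in $\mathcal{V}$ with invertible antipode. Then the category $r\mathcal{YD}_H^{\mathcal{V}}$ of ribbon Yetter--Drinfeld modules over $H$ in $\mathcal{V}$ is a strict ribbon category.
   Context: An object also denotes its identity morphism; juxtaposition of morphisms is composition; $I$ is the unit object; $P_{X,Y}:X\otimes Y\to Y\otimes X$ denotes the symmetry of $\mathcal{V}$. A Hopf algebra in $\mathcal{V}$ is $(H,\mu,\eta,\Delta,\epsilon,S)$ where $(H,\mu:H\otimes H\to H,\eta:I\to H)$ is a monoid, $(H,\Delta:H\to H\otimes H,\epsilon:H\to I)$ is a comonoid, $\epsilon\eta=\mathrm{id}_I$, $\epsilon\mu=\epsilon\otimes\epsilon$, $\Delta\eta=\eta\otimes\eta$, $\Delta\mu=(\mu\otimes\mu)(H\otimes P_{H,H}\otimes H)(\Delta\otimes\Delta)$, and $S:H\to H$ satisfies $\mu(S\otimes H)\Delta=\mu(H\otimes S)\Delta=\eta\epsilon$. Invertible antipode means $S$ is an isomorphism in $\mathcal{V}$. Put $\mu_3=\mu(\mu\otimes H)$, $\Delta_3=(\Delta\otimes H)\Delta$. A (left-left) Yetter--Drinfeld module over $H$ in $\mathcal{V}$ is a triple $(X,\alpha,\beta)$ with $(X,\alpha:H\otimes X\to X)$ a left $H$-module, $(X,\beta:X\to H\otimes X)$ a left $H$-comodule, and $$\beta\alpha=(\mu_3\otimes\alpha)\,\sigma\,(H\otimes H\otimes S\otimes H\otimes X)(\Delta_3\otimes\beta),$$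 where $\sigma$ is the automorphism of $H\otimes H\otimes H\otimes H\otimes X$ built from symmetries that exchanges the second and fourth tensor factors (in elements: $\beta(hx)=\sum h_1x_{-1}S(h_3)\otimes h_2x_0$). Morphisms are morphisms in $\mathcal{V}$ that are both $H$-module and $H$-comodule morphisms. The category $\mathcal{YD}_H^{\mathcal{V}}$ of Yetter--Drinfeld modules is strict braided monoidal: the unit is $(I,\epsilon,\eta)$; $(X,\alpha,\beta)\otimes(X',\alpha',\beta')=(X\otimes X',\alpha'',\beta'')$ with $\alpha''=(\alpha\otimes\alpha')(H\otimes P_{H,X}\otimes X')(\Delta\otimes X\otimes X')$ and $\beta''=(\mu\otimes X\otimes X')(H\otimes P_{X,H}\otimes X')(\beta\otimes\beta')$; the braiding is $\psi_{X,X'}=(\alpha'\otimes X)(H\otimes P_{X,X'})(\beta\otimes X')$. In a strict monoidal category $\mathcal{M}$, a duality is $(X,X^*,d_X,b_X)$ with $d_X:X^*\otimes X\to I$, $b_X:I\to X\otimes X^*$, $(X\otimes d_X)(b_X\otimes X)=\mathrm{id}_X$, $(d_X\otimes X^* )(X^*\otimes b_X)=\mathrm{id}_{X^*}$. A pivotal object is a sextuple $(X,X^*,d_X,b_X,d_{X^*},b_{X^*})$ such that both $(X,X^*,d_X,b_X)$ and $(X^*,X,d_{X^*},b_{X^*})$ are dualities. If $\mathcal{M}$ is braided with braiding $\psi$, a ribbon object is a pivotal object with $c^R_X=c^L_X$, where $c^R_X=(X\otimes d_{X^*})(\psi_{X,X}\otimes X^* )(X\otimes b_X)$ and $c^L_X=(d_X\otimes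 X)(X^*\otimes\psi_{X,X})(b_{X^*}\otimes X)$. A morphism from the pivotal (or ribbon) object $(X,X^*,\dots)$ to $(Y,Y^*,\dots)$ is a morphism $f:X\to Y$ in $\mathcal{M}$ with $f=f^{**}$, where $f^*=(d_Y\otimes X^* )(Y^*\otimes f\otimes X^* )(Y^*\otimes b_X)$ and $f^{**}=(d_{X^*}\otimes Y)(X\otimes f^*\otimes Y)(X\otimes b_{Y^*})$. Let $\mathcal{M}^r$ denote the category of ribbon objects in $\mathcal{M}$ and these morphisms. Its structure is: unit $(I,I,\mathrm{id}_I,\mathrm{id}_I,\mathrm{id}_I,\mathrm{id}_I)$; tensor product of $(X,X^*,\dots)$ and $(Y,Y^*,\dots)$ equal to $(X\otimes Y,Y^*\otimes X^*,d_{X\otimes Y},b_{X\otimes Y},d_{Y^*\otimes X^*},b_{Y^*\otimes X^*})$ with $d_{X\otimes Y}=d_Y(Y^*\otimes d_X\otimes Y)$, $b_{X\otimes Y}=(X\otimes b_Y\otimes X^* )b_X$, $d_{Y^*\otimes X^*}=d_{X^*}(X\otimes d_{Y^*}\otimes X^* )$, $b_{Y^*\otimes X^*}=(Y^*\otimes b_{X^*}\otimes Y)b_{Y^*}$; tensor product of morphisms and braiding as in $\mathcal{M}$; dual $(X^*,X,d_{X^*},b_{X^*},d_X,b_X)$ with evaluation $d_X$ and coevaluation $b_X$. A ribbon Yetter--Drinfeld module over $H$ in $\mathcal{V}$ is a ribbon object in $\mathcal{YD}_H^{\mathcal{V}}$, and $r\mathcal{YD}_H^{\mathcal{V}}:=(\mathcal{YD}_H^{\mathcal{V}})^r$.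 A strict pivotal category is a strict monoidal category $\mathcal{N}$ with chosen left duals such that $(-)^*:\mathcal{N}^{\mathrm{op}}\to\mathcal{N}$ is a strict monoidal functor ($\mathcal{N}^{\mathrm{op}}$ with reversed tensor product), $d_I=b_I=\mathrm{id}_I$, $d_{X\otimes Y}=d_Y(Y^*\otimes d_X\otimes Y)$, $b_{X\otimes Y}=(X\otimes b_Y\otimes X^* )b_X$, and $(-)^{**}=\mathrm{Id}_{\mathcal{N}}$. A strict ribbon category is a strict pivotal category with a braiding such that $c^R_X=c^L_X$ for every object $X$, with $c^R_X,c^L_X$ defined by the formulas above using the chosen duals of $X$ and $X^*$. *)

(* Defs.v *)
(* Strict monoidal categories, Hopf algebras, Yetter-Drinfeld modules and
   ribbon objects.

   Encoding.  In a strict monoidal category (X ⊗ Y) ⊗ Z and X ⊗ (Y ⊗ Z) are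
   equal but not convertible, so with a dependent family of hom-types almost no
   string-diagram formula would typecheck without transports.  Arrows are
   therefore elements of one type [arr C], and "f is a morphism from X to Y" is
   a relation [hom X Y f].  Composition and tensor product are total on [arr C];
   their values are constrained only on arrows that are well typed.  An arrow
   may lie in several hom-sets: the hom-set C(X, Y) is {f | hom X Y f}.
   Likewise the objects of C are {X | isob X}; for instance an arbitrary triple
   (X, α, β) is an element of the object type of the category of Yetter-Drinfeld
   modules, and [isob] selects those which are Yetter-Drinfeld modules.

   Each categorical structure is a record of data together with a separate
   Prop-valued record of its laws, closure under the operations included. *)

Set Implicit Arguments.
Unset Strict Implicit.
Unset Printing Implicit Defensive.

(** * Categories *)

Record cat_data := CatData {
  ob : Type;
  arr : Type;
  isob : ob -> Prop;
  hom : ob -> ob -> arr -> Prop;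
  idm : ob -> arr;
  comp : arr -> arr -> arr
}.

(* An object also denotes its identity morphism. *)
Coercion idm : ob >-> arr.

Notation "g ∘ f" := (comp g f) (at level 50, left associativity).

Record category (C : cat_data) : Prop := {
  hom_isob : forall (X Y : ob C) (f : arr C), hom X Y f -> isob X /\ isob Y;
  idm_hom : forall X : ob C, isob X -> hom X X X;
  comp_hom : forall (X Y Z : ob C) (f g : arr C),
    hom X Y f -> hom Y Z g -> hom X Z (g ∘ f);
  comp_idl : forall (X Y : ob C) (f : arr C), hom X Y f -> Y ∘ f = f;
  comp_idr : forall (X Y : ob C) (f : arr C), hom X Y f -> f ∘ X = f;
  comp_assoc : forall (X Y Z W : ob C) (f g h : arr C),
    hom X Y f -> hom Y Z g -> hom Z W h -> h ∘ (g ∘ f) = (h ∘ g) ∘ f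
}.

Definition is_iso (C : cat_data) (X Y : ob C) (f : arr C) : Prop :=
  hom X Y f /\
  exists g : arr C, hom Y X g /\ g ∘ f = X /\ f ∘ g = Y.

(** * Strict monoidal categories *)

Record mon_data := MonData {
  mon_cat :> cat_data;
  unit_ob : ob mon_cat;
  tens_ob : ob mon_cat -> ob mon_cat -> ob mon_cat;
  tens_arr : arr mon_cat -> arr mon_cat -> arr mon_cat
}.

Arguments unit_ob {m}.

(* [⊗] is the tensor product of objects and [⊠] that of morphisms; both bind
   tighter than composition. *)
Notation "X ⊗ Y" := (tens_ob X Y) (at level 40, left associativity).
Notation "f ⊠ g" := (tens_arr f g) (at level 40, left associativity).

Record strict_monoidal (M : mon_data) : Prop := {
  mon_category : category M;
  unit_isob : isob (unit_ob : ob M);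
  tens_isob : forall X Y : ob M, isob X -> isob Y -> isob (X ⊗ Y);
  tens_hom : forall (X X' Y Y' : ob M) (f g : arr M),
    hom X X' f -> hom Y Y' g -> hom (X ⊗ Y) (X' ⊗ Y') (f ⊠ g);
  tens_idm : forall X Y : ob M,
    isob X -> isob Y -> X ⊠ Y = idm (X ⊗ Y);
  tens_comp : forall (X X' X'' Y Y' Y'' : ob M) (f f' g g' : arr M),
    hom X X' f -> hom X' X'' f' -> hom Y Y' g -> hom Y' Y'' g' ->
    (f' ∘ f) ⊠ (g' ∘ g) = (f' ⊠ g') ∘ (f ⊠ g);
  tens_ob_assoc : forall X Y Z : ob M,
    isob X -> isob Y -> isob Z -> X ⊗ (Y ⊗ Z) = (X ⊗ Y) ⊗ Z;
  tens_ob_unitl : forall X : ob M, isob X -> unit_ob ⊗ X = X;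
  tens_ob_unitr : forall X : ob M, isob X -> X ⊗ unit_ob = X;
  tens_arr_assoc : forall (X X' Y Y' Z Z' : ob M) (f g h : arr M),
    hom X X' f -> hom Y Y' g -> hom Z Z' h -> f ⊠ (g ⊠ h) = (f ⊠ g) ⊠ h;
  tens_arr_unitl : forall (X Y : ob M) (f : arr M),
    hom X Y f -> unit_ob ⊠ f = f;
  tens_arr_unitr : forall (X Y : ob M) (f : arr M),
    hom X Y f -> f ⊠ unit_ob = f
}.

(** * Braided and symmetric strict monoidal categories *)

Record braided_data := BraidedData {
  br_mon :> mon_data;
  braid : ob br_mon -> ob br_mon -> arr br_mon
}.

Record strict_braided (B : braided_data) : Prop := {
  br_strict_monoidal : strict_monoidal B;
  braid_iso : forall X Y : ob B,
    isob X -> isob Y -> is_iso (X ⊗ Y) (Y ⊗ X) (braid X Y);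
  braid_nat : forall (X X' Y Y' : ob B) (f g : arr B),
    hom X X' f -> hom Y Y' g ->
    braid X' Y' ∘ (f ⊠ g) = (g ⊠ f) ∘ braid X Y;
  braid_tensl : forall X Y Z : ob B, isob X -> isob Y -> isob Z ->
    braid (X ⊗ Y) Z = (braid X Z ⊠ Y) ∘ (X ⊠ braid Y Z);
  braid_tensr : forall X Y Z : ob B, isob X -> isob Y -> isob Z ->
    braid X (Y ⊗ Z) = (Y ⊠ braid X Z) ∘ (braid X Y ⊠ Z)
}.

Record strict_symmetric (V : braided_data) : Prop := {
  sym_strict_braided : strict_braided V;
  braid_sym : forall X Y : ob V,
    isob X -> isob Y -> braid Y X ∘ braid X Y = idm (X ⊗ Y)
}.

(** * Hopf algebras *)

Record hopf_data (V : braided_data) := HopfData {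
  hcar :> ob V;
  hmul : arr V;
  hunit : arr V;
  hcomul : arr V;
  hcounit : arr V;
  hanti : arr V
}.

Record hopf_algebra (V : braided_data) (H : hopf_data V) : Prop := {
  hcar_isob : isob (hcar H);
  hmul_hom : hom (H ⊗ H) H (hmul H);
  hunit_hom : hom unit_ob H (hunit H);
  hcomul_hom : hom H (H ⊗ H) (hcomul H);
  hcounit_hom : hom H unit_ob (hcounit H);
  hanti_hom : hom H H (hanti H);
  hmul_assoc : hmul H ∘ (hmul H ⊠ hcar H) = hmul H ∘ (hcar H ⊠ hmul H);
  hmul_unitl : hmul H ∘ (hunit H ⊠ hcar H) = hcar H;
  hmul_unitr : hmul H ∘ (hcar H ⊠ hunit H) = hcar H;
  hcomul_coassoc :
    (hcomul H ⊠ hcar H) ∘ hcomul H = (hcar H ⊠ hcomul H) ∘ hcomul H;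
  hcomul_counitl : (hcounit H ⊠ hcar H) ∘ hcomul H = hcar H;
  hcomul_counitr : (hcar H ⊠ hcounit H) ∘ hcomul H = hcar H;
  hcounit_unit : hcounit H ∘ hunit H = unit_ob;
  hcounit_mul : hcounit H ∘ hmul H = hcounit H ⊠ hcounit H;
  hcomul_unit : hcomul H ∘ hunit H = hunit H ⊠ hunit H;
  hcomul_mul :
    hcomul H ∘ hmul H =
    (hmul H ⊠ hmul H) ∘ (hcar H ⊠ braid H H ⊠ hcar H) ∘ (hcomul H ⊠ hcomul H);
  hanti_left :
    hmul H ∘ (hanti H ⊠ hcar H) ∘ hcomul H = hunit H ∘ hcounit H;
  hanti_right :
    hmul H ∘ (hcar H ⊠ hanti H) ∘ hcomul H = hunit H ∘ hcounit H
}.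

Definition has_invertible_antipode (V : braided_data) (H : hopf_data V) : Prop :=
  is_iso H H (hanti H).

(** * Yetter-Drinfeld modules *)

Record yd_data (V : braided_data) := YDData {
  yd_car :> ob V;
  yd_act : arr V;
  yd_coact : arr V
}.

Section YetterDrinfeld.

Variables (V : braided_data) (Ha : hopf_data V).

Local Notation H := (hcar Ha).
Local Notation μ := (hmul Ha).
Local Notation η := (hunit Ha).
Local Notation Δ := (hcomul Ha).
Local Notation ϵ := (hcounit Ha).
Local Notation S := (hanti Ha).
Local Notation P := (@braid V).

Definition hmul3 : arr V := μ ∘ (μ ⊠ H).
Definition hcomul3 : arr V := (Δ ⊠ H) ∘ Δ.

(* The automorphism of H ⊗ H ⊗ H ⊗ H ⊗ X exchanging the second and fourth
   factors, as the product (2 3)(3 4)(2 3) in the Coxeter generators. *)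
Definition yd_swap24 (X : ob V) : arr V :=
  H ⊠ ((P H H ⊠ H) ∘ (H ⊠ P H H) ∘ (P H H ⊠ H)) ⊠ X.

Record is_yd_module (X : yd_data V) : Prop := {
  yd_car_isob : isob (yd_car X);
  yd_act_hom : hom (H ⊗ X) X (yd_act X);
  yd_coact_hom : hom X (H ⊗ X) (yd_coact X);
  yd_act_mul : yd_act X ∘ (μ ⊠ yd_car X) = yd_act X ∘ (H ⊠ yd_act X);
  yd_act_unit : yd_act X ∘ (η ⊠ yd_car X) = yd_car X;
  yd_coact_comul :
    (Δ ⊠ yd_car X) ∘ yd_coact X = (H ⊠ yd_coact X) ∘ yd_coact X;
  yd_coact_counit : (ϵ ⊠ yd_car X) ∘ yd_coact X = yd_car X;
  yd_compat :
    yd_coact X ∘ yd_act X =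
    (hmul3 ⊠ yd_act X) ∘ yd_swap24 X ∘ (H ⊠ H ⊠ S ⊠ H ⊠ yd_car X)
      ∘ (hcomul3 ⊠ yd_coact X)
}.

Record is_yd_morphism (X Y : yd_data V) (f : arr V) : Prop := {
  yd_mor_dom : is_yd_module X;
  yd_mor_cod : is_yd_module Y;
  yd_mor_hom : hom (yd_car X) (yd_car Y) f;
  yd_mor_act : f ∘ yd_act X = yd_act Y ∘ (H ⊠ f);
  yd_mor_coact : yd_coact Y ∘ f = (H ⊠ f) ∘ yd_coact X
}.

Definition yd_unit : yd_data V := YDData unit_ob ϵ η.

Definition yd_tens (X X' : yd_data V) : yd_data V :=
  YDData (X ⊗ X')
    ((yd_act X ⊠ yd_act X') ∘ (H ⊠ P H X ⊠ yd_car X')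
       ∘ (Δ ⊠ yd_car X ⊠ yd_car X'))
    ((μ ⊠ yd_car X ⊠ yd_car X') ∘ (H ⊠ P X H ⊠ yd_car X')
       ∘ (yd_coact X ⊠ yd_coact X')).

Definition yd_braid (X X' : yd_data V) : arr V :=
  (yd_act X' ⊠ yd_car X) ∘ (H ⊠ P X X') ∘ (yd_coact X ⊠ yd_car X').

Definition YD : braided_data :=
  @BraidedData
    (@MonData
       (@CatData (yd_data V) (arr V) is_yd_module is_yd_morphism
          (fun X => yd_car X) (@comp V))
       yd_unit yd_tens (@tens_arr V))
    yd_braid.

End YetterDrinfeld.

(** * Dualities, pivotal objects, ribbon objects *)

Record is_duality (M : mon_data) (X Xs : ob M) (d b : arr M) : Prop := {
  duality_ob : isob X;
  duality_dual_ob : isob Xs;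
  duality_ev_hom : hom (Xs ⊗ X) unit_ob d;
  duality_coev_hom : hom unit_ob (X ⊗ Xs) b;
  duality_snake : (X ⊠ d) ∘ (b ⊠ X) = X;
  duality_dual_snake : (d ⊠ Xs) ∘ (Xs ⊠ b) = Xs
}.

(* The transpose f^* : Y^* -> X^* of f : X -> Y; it depends on X and Y only
   through X^*, Y^*, b_X and d_Y. *)
Definition transpose (M : mon_data) (Xs : ob M) (bX : arr M)
    (Ys : ob M) (dY : arr M) (f : arr M) : arr M :=
  (dY ⊠ Xs) ∘ (Ys ⊠ f ⊠ Xs) ∘ (Ys ⊠ bX).

(* The right and left curls c^R_X and c^L_X; in the first [dXs] is
   d_{X^*} : X ⊗ X^* -> I, in the second [bXs] is b_{X^*} : I -> X^* ⊗ X. *)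
Definition curlR (B : braided_data) (X Xs : ob B) (bX dXs : arr B) : arr B :=
  (X ⊠ dXs) ∘ (braid X X ⊠ Xs) ∘ (X ⊠ bX).

Definition curlL (B : braided_data) (X Xs : ob B) (dX bXs : arr B) : arr B :=
  (dX ⊠ X) ∘ (Xs ⊠ braid X X) ∘ (bXs ⊠ X).

(* Sextuples (X, X^*, d_X, b_X, d_{X^*}, b_{X^*}). *)
Record piv_data (M : mon_data) := PivData {
  pv_ob : ob M;
  pv_dual : ob M;
  pv_ev : arr M;
  pv_coev : arr M;
  pv_dual_ev : arr M;
  pv_dual_coev : arr M
}.

Section Pivotal.

Variable M : mon_data.

Record is_pivotal (X : piv_data M) : Prop := {
  pivotal_duality :
    is_duality (pv_ob X) (pv_dual X) (pv_ev X) (pv_coev X);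
  pivotal_dual_duality :
    is_duality (pv_dual X) (pv_ob X) (pv_dual_ev X) (pv_dual_coev X)
}.

Definition piv_unit : piv_data M :=
  @PivData M unit_ob unit_ob
    (idm unit_ob) (idm unit_ob) (idm unit_ob) (idm unit_ob).

Definition piv_tens (X Y : piv_data M) : piv_data M :=
  PivData (pv_ob X ⊗ pv_ob Y) (pv_dual Y ⊗ pv_dual X)
    (pv_ev Y ∘ (pv_dual Y ⊠ pv_ev X ⊠ pv_ob Y))
    ((pv_ob X ⊠ pv_coev Y ⊠ pv_dual X) ∘ pv_coev X)
    (pv_dual_ev X ∘ (pv_ob X ⊠ pv_dual_ev Y ⊠ pv_dual X))
    ((pv_dual Y ⊠ pv_dual_coev X ⊠ pv_ob Y) ∘ pv_dual_coev Y).

Definition piv_dual (X : piv_data M) : piv_data M :=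
  PivData (pv_dual X) (pv_ob X)
    (pv_dual_ev X) (pv_dual_coev X) (pv_ev X) (pv_coev X).

Definition piv_transpose (X Y : piv_data M) (f : arr M) : arr M :=
  transpose (pv_dual X) (pv_coev X) (pv_dual Y) (pv_ev Y) f.

(* f^** : X -> Y for f : X -> Y, i.e.
   (d_{X^*} ⊗ Y)(X ⊗ f^* ⊗ Y)(X ⊗ b_{Y^*}). *)
Definition piv_bitranspose (X Y : piv_data M) (f : arr M) : arr M :=
  transpose (pv_ob Y) (pv_dual_coev Y) (pv_ob X) (pv_dual_ev X)
    (piv_transpose X Y f).

End Pivotal.

(** * The category of ribbon objects *)

Section Ribbon.

Variable M : braided_data.

Record is_ribbon (X : piv_data M) : Prop := {
  ribbon_pivotal : is_pivotal X;
  ribbon_curl :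
    curlR (pv_ob X) (pv_dual X) (pv_coev X) (pv_dual_ev X) =
    curlL (pv_ob X) (pv_dual X) (pv_ev X) (pv_dual_coev X)
}.

Record is_ribbon_morphism (X Y : piv_data M) (f : arr M) : Prop := {
  ribbon_mor_dom : is_ribbon X;
  ribbon_mor_cod : is_ribbon Y;
  ribbon_mor_hom : hom (pv_ob X) (pv_ob Y) f;
  ribbon_mor_bitranspose : f = piv_bitranspose X Y f
}.

Definition ribbon_cat : braided_data :=
  @BraidedData
    (@MonData
       (@CatData (piv_data M) (arr M) is_ribbon is_ribbon_morphism
          (fun X => idm (pv_ob X)) (@comp M))
       (@piv_unit M) (@piv_tens M) (@tens_arr M))
    (fun X Y => braid (pv_ob X) (pv_ob Y)).

End Ribbon.

(** * Strict pivotal and strict ribbon categories *)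

(* A choice of left duals. *)
Record dual_data (N : mon_data) := DualData {
  dual : ob N -> ob N;
  ev : ob N -> arr N;
  coev : ob N -> arr N
}.

Definition dual_arr (N : mon_data) (D : dual_data N) (X Y : ob N) (f : arr N)
  : arr N := transpose (dual D X) (coev D X) (dual D Y) (ev D Y) f.

Record strict_pivotal (N : mon_data) (D : dual_data N) : Prop := {
  piv_strict_monoidal : strict_monoidal N;
  piv_duality : forall X : ob N,
    isob X -> is_duality X (dual D X) (ev D X) (coev D X);
  dual_arr_hom : forall (X Y : ob N) (f : arr N),
    hom X Y f -> hom (dual D Y) (dual D X) (dual_arr D X Y f);
  dual_arr_idm : forall X : ob N, isob X -> dual_arr D X X X = dual D X;
  dual_arr_comp : forall (X Y Z : ob N) (f g : arr N),
    hom X Y f -> hom Y Z g ->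
    dual_arr D X Z (g ∘ f) = dual_arr D X Y f ∘ dual_arr D Y Z g;
  dual_unit : dual D unit_ob = unit_ob;
  dual_tens : forall X Y : ob N, isob X -> isob Y ->
    dual D (X ⊗ Y) = dual D Y ⊗ dual D X;
  dual_arr_tens : forall (X X' Y Y' : ob N) (f g : arr N),
    hom X X' f -> hom Y Y' g ->
    dual_arr D (X ⊗ Y) (X' ⊗ Y') (f ⊠ g) =
    dual_arr D Y Y' g ⊠ dual_arr D X X' f;
  ev_unit : ev D unit_ob = unit_ob;
  coev_unit : coev D unit_ob = unit_ob;
  ev_tens : forall X Y : ob N, isob X -> isob Y ->
    ev D (X ⊗ Y) = ev D Y ∘ (dual D Y ⊠ ev D X ⊠ Y);
  coev_tens : forall X Y : ob N, isob X -> isob Y ->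
    coev D (X ⊗ Y) = (X ⊠ coev D Y ⊠ dual D X) ∘ coev D X;
  dual_dual : forall X : ob N, isob X -> dual D (dual D X) = X;
  dual_arr_dual_arr : forall (X Y : ob N) (f : arr N),
    hom X Y f ->
    dual_arr D (dual D Y) (dual D X) (dual_arr D X Y f) = f
}.

Arguments strict_pivotal N D : clear implicits.

Record strict_ribbon (N : braided_data) (D : dual_data N) : Prop := {
  rib_strict_pivotal : strict_pivotal N D;
  rib_strict_braided : strict_braided N;
  rib_curl : forall X : ob N, isob X ->
    curlR X (dual D X) (coev D X) (ev D (dual D X)) =
    curlL X (dual D X) (ev D X) (coev D (dual D X))
}.

Arguments strict_ribbon N D : clear implicits.

(** * Ribbon Yetter-Drinfeld modules *)

Definition ribbon_cat_duals (M : braided_data) : dual_data (ribbon_cat M) :=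
  @DualData (ribbon_cat M) (@piv_dual M) (@pv_ev M) (@pv_coev M).

Definition rYD (V : braided_data) (H : hopf_data V) : braided_data :=
  ribbon_cat (YD H).

Definition rYD_duals (V : braided_data) (H : hopf_data V) : dual_data (rYD H) :=
  ribbon_cat_duals (YD H).

(* Main.v *)
From Stdlib Require Import List Arith Bool Permutation.
From Corelib Require Import ssreflect.
Require Import Defs.
Import ListNotations.

Set Implicit Arguments.
Unset Strict Implicit.
Unset Printing Implicit Defensive.

(* For every strict braided category M the ribbon objects of M form a strict
   ribbon category.  Indeed (ψ_{X,Y})^* = ψ_{X^*,Y^*}, so that braidings are
   fixed by double transposition; computing the curls of X ⊗ Y as iterated
   partial traces gives c_{X⊗Y} = (c_X ⊗ c_Y) ψ_{Y,X} ψ_{X,Y} for both curls;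
   and c^R_{X^*} = (c^L_X)^*, c^L_{X^*} = (c^R_X)^*.  It remains to see that
   Yetter-Drinfeld modules are braided.  By the antipode axioms, the
   compatibility of action and coaction is equivalent to
     Σ (h₁x)₋₁ h₂ ⊗ (h₁x)₀ = Σ h₁ x₋₁ ⊗ h₂ x₀,
   which passes to tensor products and says that ψ is H-linear; ψ is inverted
   by y ⊗ x ↦ Σ x₀ ⊗ S⁻¹(x₋₁) y.

   Equations between string diagrams are decided by computation.  A planar
   diagram is normalised by interchange.  In a symmetric category a diagram is
   determined by which box is applied to which wires: by coherence for
   permutations its value does not depend on the order in which independent
   boxes are applied, nor on how the wires are arranged in between. *)

(** Strictness shapes the proof: equal objects need not be convertible, and every categorical law
    carries typing hypotheses. Terms are therefore reified over words of atoms, whose equality is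
    decidable, and the typing of a whole diagram is computed at once. There are two checkers because
    a crossing means different things in the two settings. In a general braided category a crossing
    is not determined by its permutation, so braidings are opaque boxes there, only interchange is
    automatic, and naturality, hexagons and snakes are applied by hand. In the symmetric category V
    a crossing is no more than a permutation, so it leaves no trace in the diagram beyond the names
    of the wires. The planar checker also proves the lemmas on which the symmetric one rests.
    Soundness is proved for both, completeness for neither. Invertibility of the antipode enters
    through the inverse of the braiding. An inverse of a morphism is again a morphism, for
    Yetter-Drinfeld modules as for ribbon objects, so this inverse need only be exhibited in V. *)

Local Notation LHS := (X in X = _)%pattern.
Local Notation RHS := (X in _ = X)%pattern.

(** * Formal terms *)

Inductive oexp := OUnit | OAtom (a : nat) | OTens (x y : oexp).

Fixpoint flat (o : oexp) : list nat :=
  match o with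
  | OUnit => []
  | OAtom a => [a]
  | OTens x y => flat x ++ flat y
  end.

Inductive term :=
| TId (o : oexp)
| TGen (n : nat)
| TBraid (o o' : oexp)
| TComp (g f : term)
| TTens (f g : term).

Definition list_nat_eq_dec := list_eq_dec Nat.eq_dec.

Section Strings.

Variables (M : mon_data) (M_mon : strict_monoidal M).

Let M_cat := mon_category M_mon.

Record gen := Gen { gen_arr : arr M; gen_src : oexp; gen_tgt : oexp }.

Variables (atoms : list (ob M)) (gens : list gen).

(** An index out of range denotes the unit object, and for boxes its identity, so every index is
    well typed and no bounds have to be carried along. *)
Definition atom (a : nat) : ob M := nth a atoms unit_ob.
Definition gen_at (n : nat) : gen := nth n gens (Gen unit_ob OUnit OUnit).

Fixpoint oden (o : oexp) : ob M :=
  match o with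
  | OUnit => unit_ob
  | OAtom a => atom a
  | OTens x y => oden x ⊗ oden y
  end.

Definition gen_typed (g : gen) : Prop :=
  hom (oden (gen_src g)) (oden (gen_tgt g)) (gen_arr g).

(** No law of the braiding is assumed in this section. Typing asks only that its values have the
    right source and target, and planar normalization rejects [TBraid]. *)
Variable br : ob M -> ob M -> arr M.

Fixpoint tden (t : term) : arr M :=
  match t with
  | TId o => oden o
  | TGen n => gen_arr (gen_at n)
  | TBraid o o' => br (oden o) (oden o')
  | TComp g f => tden g ∘ tden f
  | TTens f g => tden f ⊠ tden g
  end.

Fixpoint tens_list (w : list nat) : ob M :=
  match w with
  | [] => unit_ob
  | a :: w => atom a ⊗ tens_list w
  end.

Local Notation T := tens_list.

Definition src (n : nat) := flat (gen_src (gen_at n)).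
Definition tgt (n : nat) := flat (gen_tgt (gen_at n)).

Definition typed (u v : list nat) (f : arr M) : Prop := hom (T u) (T v) f.

Hypothesis atoms_isob : Forall (@isob M) atoms.
Hypothesis gens_typed : Forall gen_typed gens.

Lemma atom_isob a : isob (atom a).
Proof.
rewrite /atom; case: (nth_in_or_default a atoms unit_ob) => [h|->].
  by move: atoms_isob => /Forall_forall; apply.
exact: unit_isob M_mon.
Qed.

Lemma tens_list_isob w : isob (T w).
Proof.
elim: w => [|a w IH] /=; first exact: unit_isob M_mon.
exact: (tens_isob M_mon (atom_isob a) IH).
Qed.

Lemma tens_list_app u v : T (u ++ v) = T u ⊗ T v.
Proof.
elim: u => [|a u IH] /=.
  by rewrite (tens_ob_unitl M_mon (tens_list_isob v)).
by rewrite IH (tens_ob_assoc M_mon (atom_isob a) (tens_list_isob u) (tens_list_isob v)).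
Qed.

(** This is where strictness is used up: all bracketings of a word denote one object, so
    composability can be tested on words. *)
Lemma oden_flat o : oden o = T (flat o).
Proof.
elim: o => [|a|x IHx y IHy] //=.
  by rewrite (tens_ob_unitr M_mon (atom_isob a)).
by rewrite tens_list_app IHx IHy.
Qed.

Lemma gen_typed_at n : typed (src n) (tgt n) (gen_arr (gen_at n)).
Proof.
rewrite /typed /src /tgt -!oden_flat /gen_at.
case: (nth_in_or_default n gens (Gen unit_ob OUnit OUnit)) => [h|->].
  by move: gens_typed => /Forall_forall h'; exact: h'.
exact: (idm_hom M_cat (unit_isob M_mon)).
Qed.

Lemma typed_id w : typed w w (T w).
Proof. exact: (idm_hom M_cat (tens_list_isob w)). Qed.

Lemma typed_comp u v w f g :
  typed u v f -> typed v w g -> typed u w (g ∘ f).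
Proof. exact: (comp_hom M_cat). Qed.

Lemma typed_tens u v f u' v' f' w w' :
  typed u v f -> typed u' v' f' -> w = u ++ u' -> w' = v ++ v' ->
  typed w w' (f ⊠ f').
Proof.
move=> hf hf' -> ->; rewrite /typed !tens_list_app; exact: (tens_hom M_mon hf hf').
Qed.

Lemma id_comp u v f : typed u v f -> T v ∘ f = f.
Proof. exact: (comp_idl M_cat). Qed.

Lemma comp_id u v f : typed u v f -> f ∘ T u = f.
Proof. exact: (comp_idr M_cat). Qed.

Lemma comp_compA t u v w f g h :
  typed t u f -> typed u v g -> typed v w h -> h ∘ (g ∘ f) = h ∘ g ∘ f.
Proof. exact: (comp_assoc M_cat). Qed.

Lemma tens_tensA u u' v v' w w' f g h :
  typed u u' f -> typed v v' g -> typed w w' h -> f ⊠ (g ⊠ h) = f ⊠ g ⊠ h.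
Proof. exact: (tens_arr_assoc M_mon). Qed.

Lemma id_tens u v : T u ⊠ T v = T (u ++ v).
Proof.
by rewrite tens_list_app (tens_idm M_mon (tens_list_isob u) (tens_list_isob v)).
Qed.

Lemma nil_tens u v f : typed u v f -> T [] ⊠ f = f.
Proof. exact: (tens_arr_unitl M_mon). Qed.

Lemma tens_nil u v f : typed u v f -> f ⊠ T [] = f.
Proof. exact: (tens_arr_unitr M_mon). Qed.

Lemma comp_tens u v w f g u' v' w' f' g' :
  typed u v f -> typed v w g -> typed u' v' f' -> typed v' w' g' ->
  (g ⊠ g') ∘ (f ⊠ f') = (g ∘ f) ⊠ (g' ∘ f').
Proof. by move=> hf hg hf' hg'; rewrite (tens_comp M_mon hf hg hf' hg'). Qed.

Lemma comp_tens_l u v w f g s : typed u v f -> typed v w g ->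
  (g ⊠ T s) ∘ (f ⊠ T s) = (g ∘ f) ⊠ T s.
Proof.
move=> hf hg; rewrite (comp_tens hf hg (typed_id s) (typed_id s)).
by rewrite (id_comp (typed_id s)).
Qed.

Lemma comp_tens_r u v w f g s : typed u v f -> typed v w g ->
  (T s ⊠ g) ∘ (T s ⊠ f) = T s ⊠ (g ∘ f).
Proof.
move=> hf hg; rewrite (comp_tens (typed_id s) (typed_id s) hf hg).
by rewrite (id_comp (typed_id s)).
Qed.

Lemma tens_split u v f u' v' f' : typed u v f -> typed u' v' f' ->
  f ⊠ f' = (T v ⊠ f') ∘ (f ⊠ T u').
Proof.
move=> hf hf'; rewrite (comp_tens hf (typed_id _) (typed_id _) hf').
by rewrite (id_comp hf) (comp_id hf').
Qed.

Lemma tens_split' u v f u' v' f' : typed u v f -> typed u' v' f' ->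
  f ⊠ f' = (f ⊠ T v') ∘ (T u ⊠ f').
Proof.
move=> hf hf'; rewrite (comp_tens (typed_id _) hf hf' (typed_id _)).
by rewrite (id_comp hf') (comp_id hf).
Qed.

Fixpoint ttype (t : term) : option (list nat * list nat) :=
  match t with
  | TId o => Some (flat o, flat o)
  | TGen n => Some (src n, tgt n)
  | TBraid o o' => Some (flat o ++ flat o', flat o' ++ flat o)
  | TComp g f =>
      match ttype f, ttype g with
      | Some (a, b), Some (b', c) =>
          if list_nat_eq_dec b b' is left _ then Some (a, c) else None
      | _, _ => None
      end
  | TTens f g =>
      match ttype f, ttype g with
      | Some (a, b), Some (c, d) => Some (a ++ c, b ++ d)
      | _, _ => None
      end
  end.

Definition type_check (t : term) (x y : oexp) : bool :=
  if ttype t is Some (a, b) then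
    if list_nat_eq_dec a (flat x) is left _ then
      if list_nat_eq_dec b (flat y) is left _ then true else false
    else false
  else false.

Section Typing.

Hypothesis br_hom :
  forall X Y : ob M, isob X -> isob Y -> hom (X ⊗ Y) (Y ⊗ X) (br X Y).

Lemma ttype_sound t a b : ttype t = Some (a, b) -> typed a b (tden t).
Proof.
elim: t a b => [o|n|o o'|g IHg f IHf|f IHf g IHg] a b //=.
- by move=> [<- <-]; rewrite oden_flat; exact: typed_id.
- by move=> [<- <-]; exact: gen_typed_at.
- move=> [<- <-]; rewrite /typed !oden_flat !tens_list_app.
  by apply: br_hom; exact: tens_list_isob.
- case: (ttype f) IHf => [[a1 b1]|] //; case: (ttype g) IHg => [[b2 c]|] //.
  move=> IHg IHf; case: list_nat_eq_dec => // e [<- <-]; subst b2.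
  exact: typed_comp (IHf _ _ eq_refl) (IHg _ _ eq_refl).
- case: (ttype f) IHf => [[a1 b1]|] //; case: (ttype g) IHg => [[b2 c]|] //.
  move=> IHg IHf [<- <-].
  exact: typed_tens (IHf _ _ eq_refl) (IHg _ _ eq_refl) _ _.
Qed.

Lemma type_check_sound t x y :
  type_check t x y = true -> hom (oden x) (oden y) (tden t).
Proof.
rewrite /type_check; case e: (ttype t) => [[a b]|] //.
case: list_nat_eq_dec => // ea; case: list_nat_eq_dec => // eb _; subst a b.
by move: (ttype_sound e); rewrite /typed -!oden_flat.
Qed.

End Typing.

(** * Planar diagrams *)

(** One box [n] at one height, with identities on the words [u] to its left and [v] to its right. A
    planar diagram is a list of layers, the first applied first. *)
Definition layer : Type := list nat * nat * list nat.

Definition lsrc (l : layer) := let '(u, n, v) := l in u ++ src n ++ v.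
Definition ltgt (l : layer) := let '(u, n, v) := l in u ++ tgt n ++ v.
Definition lden (l : layer) : arr M :=
  let '(u, n, v) := l in T u ⊠ (gen_arr (gen_at n) ⊠ T v).

Fixpoint chain (w : list nat) (ls : list layer) (w' : list nat) : Prop :=
  match ls with
  | [] => w = w'
  | l :: ls => w = lsrc l /\ chain (ltgt l) ls w'
  end.

Fixpoint lsden (w : list nat) (ls : list layer) : arr M :=
  match ls with
  | [] => T w
  | l :: ls => lsden (ltgt l) ls ∘ lden l
  end.

Lemma typed_layer l : typed (lsrc l) (ltgt l) (lden l).
Proof.
case: l => [[u n] v] /=.
apply: typed_tens; eauto using typed_id.
apply: typed_tens; eauto using typed_id, gen_typed_at.
Qed.

Lemma typed_layers ls w w' : chain w ls w' -> typed w w' (lsden w ls).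
Proof.
elim: ls w => [|l ls IH] w /=; first by move=> ->; exact: typed_id.
by case=> -> /IH h; exact: typed_comp (typed_layer l) h.
Qed.

Lemma chain_app ls ls' w w' w'' :
  chain w ls w' -> chain w' ls' w'' -> chain w (ls ++ ls') w''.
Proof.
elim: ls w => [|l ls IH] w /=; first by move=> ->.
by case=> -> h h'; split=> //; exact: IH.
Qed.

Lemma lsden_app ls ls' w w' w'' :
  chain w ls w' -> chain w' ls' w'' ->
  lsden w (ls ++ ls') = lsden w' ls' ∘ lsden w ls.
Proof.
elim: ls w => [|l ls IH] w /=.
  by move=> -> h; rewrite (comp_id (typed_layers h)).
case=> _ h h'; rewrite (IH _ h h').
by rewrite (comp_compA (typed_layer l) (typed_layers h) (typed_layers h')).
Qed.

Definition lwhisk_l (s : list nat) (l : layer) : layer :=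
  let '(u, n, v) := l in (s ++ u, n, v).
Definition lwhisk_r (s : list nat) (l : layer) : layer :=
  let '(u, n, v) := l in (u, n, v ++ s).

Lemma layers_whisk_l s ls w w' : chain w ls w' ->
  chain (s ++ w) (map (lwhisk_l s) ls) (s ++ w') /\
  lsden (s ++ w) (map (lwhisk_l s) ls) = T s ⊠ lsden w ls.
Proof.
elim: ls w => [|l ls IH] w /=; first by move=> ->; rewrite id_tens.
case=> -> h; case: (IH _ h) => {IH}.
have -> : ltgt (lwhisk_l s l) = s ++ ltgt l.
  by case: l {h} => [[u n] v] /=; rewrite -app_assoc.
have -> : lsrc (lwhisk_l s l) = s ++ lsrc l.
  by case: l {h} => [[u n] v] /=; rewrite -app_assoc.
move=> hc ->; split=> //.
rewrite -(comp_tens_r s (typed_layer l) (typed_layers h)); congr (_ ∘ _).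
case: l {h hc} => [[u n] v] /=; rewrite -id_tens.
have hg := typed_tens (gen_typed_at n) (typed_id v) eq_refl eq_refl.
by rewrite (tens_tensA (typed_id s) (typed_id u) hg).
Qed.

Lemma layers_whisk_r s ls w w' : chain w ls w' ->
  chain (w ++ s) (map (lwhisk_r s) ls) (w' ++ s) /\
  lsden (w ++ s) (map (lwhisk_r s) ls) = lsden w ls ⊠ T s.
Proof.
elim: ls w => [|l ls IH] w /=; first by move=> ->; rewrite id_tens.
case=> -> h; case: (IH _ h) => {IH}.
have -> : ltgt (lwhisk_r s l) = ltgt l ++ s.
  by case: l {h} => [[u n] v] /=; rewrite -!app_assoc.
have -> : lsrc (lwhisk_r s l) = lsrc l ++ s.
  by case: l {h} => [[u n] v] /=; rewrite -!app_assoc.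
move=> hc ->; split=> //.
rewrite -(comp_tens_l s (typed_layer l) (typed_layers h)); congr (_ ∘ _).
case: l {h hc} => [[u n] v] /=; rewrite -id_tens.
have hg := gen_typed_at n.
rewrite (tens_tensA hg (typed_id v) (typed_id s)).
by rewrite (tens_tensA (typed_id u) (typed_tens hg (typed_id v) eq_refl eq_refl) (typed_id s)).
Qed.

(** In a tensor product the boxes of [f] come first, beside the source of [g]; those of [g] follow,
    beside the target of [f]. The tactic [planar] never meets the failing case, since it reifies
    braidings as generators. *)
Fixpoint layers (t : term) : option (list nat * list layer * list nat) :=
  match t with
  | TId o => Some (flat o, [], flat o)
  | TGen n => Some (src n, [([], n, [])], tgt n)
  | TBraid _ _ => None
  | TComp g f =>
      match layers f, layers g with
      | Some (a, lf, b), Some (b', lg, c) =>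
          if list_nat_eq_dec b b' is left _ then Some (a, lf ++ lg, c) else None
      | _, _ => None
      end
  | TTens f g =>
      match layers f, layers g with
      | Some (a, lf, b), Some (c, lg, d) =>
          Some (a ++ c, map (lwhisk_r c) lf ++ map (lwhisk_l b) lg, b ++ d)
      | _, _ => None
      end
  end.

Lemma layers_sound t a ls b : layers t = Some (a, ls, b) ->
  chain a ls b /\ tden t = lsden a ls.
Proof.
elim: t a ls b => [o|n|o o'|g IHg f IHf|f IHf g IHg] a ls b //=.
- by case=> <- <- <-; rewrite oden_flat.
- have h := gen_typed_at n.
  case=> <- <- <- /=; rewrite !app_nil_r; split=> //.
  by rewrite (tens_nil h) (nil_tens h) (id_comp h).
- case: (layers f) IHf => [[[a1 lf] b1]|] //; case: (layers g) IHg => [[[b2 lg] c]|] //.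
  move=> IHg IHf; case: list_nat_eq_dec => // e [<- <- <-]; subst b2.
  case: (IHf _ _ _ eq_refl) (IHg _ _ _ eq_refl) => [cf ->] [cg ->].
  split; first exact: chain_app cf cg.
  by rewrite (lsden_app cf cg).
- case: (layers f) IHf => [[[a1 lf] b1]|] //; case: (layers g) IHg => [[[b2 lg] c]|] //.
  move=> IHg IHf [<- <- <-].
  case: (IHf _ _ _ eq_refl) (IHg _ _ _ eq_refl) => [cf ->] [cg ->].
  case: (layers_whisk_r b2 cf) (layers_whisk_l b1 cg) => [cf' ef] [cg' eg].
  split; first exact: chain_app cf' cg'.
  by rewrite (lsden_app cf' cg') ef eg (tens_split (typed_layers cf) (typed_layers cg)).
Qed.

Fixpoint strip_prefix (p l : list nat) : option (list nat) :=
  match p, l with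
  | [], _ => Some l
  | x :: p, y :: l => if Nat.eq_dec x y is left _ then strip_prefix p l else None
  | _, _ => None
  end.

Lemma strip_prefixE p l m : strip_prefix p l = Some m -> l = p ++ m.
Proof.
elim: p l => [l|x p IH [|y l]] //=; first by move=> [->].
by case: Nat.eq_dec => // -> /IH ->.
Qed.

(* Interchange of two consecutive layers, when the second one lies to the
   left of the first. *)
Definition lswap (l1 l2 : layer) : option (layer * layer) :=
  let '(u1, n1, v1) := l1 in
  let '(u2, n2, v2) := l2 in
  match strip_prefix (u2 ++ src n2) u1 with
  | Some m =>
      if list_nat_eq_dec v2 (m ++ tgt n1 ++ v1) is left _
      then Some ((u2, n2, m ++ src n1 ++ v1), (u2 ++ tgt n2 ++ m, n1, v1))
      else None
  | None => None
  end.

Lemma lswap_sound l1 l2 l1' l2' ls w w' :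
  lswap l1 l2 = Some (l2', l1') -> chain w (l1 :: l2 :: ls) w' ->
  chain w (l2' :: l1' :: ls) w' /\
  lsden w (l1 :: l2 :: ls) = lsden w (l2' :: l1' :: ls).
Proof.
case: l1 => [[u1 n1] v1]; case: l2 => [[u2 n2] v2].
rewrite /lswap; case e: strip_prefix => [m|] //.
move/strip_prefixE: e => ->; case: list_nat_eq_dec => // -> [<- <-].
move=> h; have hl := h; move: h.
rewrite /=; case=> -> [_ h].
have E : ltgt (u2, n2, m ++ tgt n1 ++ v1) = ltgt (u2 ++ tgt n2 ++ m, n1, v1).
  by rewrite /= -!app_assoc.
rewrite /= in E; rewrite E in h.
split; first by rewrite -!app_assoc in h *; do !split.
rewrite E.
have h1 := gen_typed_at n1; have h2 := gen_typed_at n2.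
set g1 := gen_arr (gen_at n1) in h1 *; set g2 := gen_arr (gen_at n2) in h2 *.
have hm : typed (m ++ src n1 ++ v1) (m ++ tgt n1 ++ v1) (T m ⊠ (g1 ⊠ T v1)).
  apply: typed_tens; eauto using typed_id; apply: typed_tens; eauto using typed_id.
have hL := typed_layers h.
have ho1 : typed (u2 ++ src n2 ++ m ++ src n1 ++ v1)
   (u2 ++ src n2 ++ m ++ tgt n1 ++ v1) (T u2 ⊠ (T (src n2) ⊠ (T m ⊠ (g1 ⊠ T v1)))).
  do 2 (apply: typed_tens; eauto using typed_id).
have ho2 : typed (u2 ++ src n2 ++ m ++ tgt n1 ++ v1)
   (u2 ++ tgt n2 ++ m ++ tgt n1 ++ v1) (T u2 ⊠ (g2 ⊠ T (m ++ tgt n1 ++ v1))).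
  do 2 (apply: typed_tens; eauto using typed_id).
have ho3 : typed (u2 ++ src n2 ++ m ++ src n1 ++ v1)
   (u2 ++ tgt n2 ++ m ++ src n1 ++ v1) (T u2 ⊠ (g2 ⊠ T (m ++ src n1 ++ v1))).
  do 2 (apply: typed_tens; eauto using typed_id).
have ho4 : typed (u2 ++ tgt n2 ++ m ++ src n1 ++ v1)
   (u2 ++ tgt n2 ++ m ++ tgt n1 ++ v1) (T u2 ⊠ (T (tgt n2) ⊠ (T m ⊠ (g1 ⊠ T v1)))).
  do 2 (apply: typed_tens; eauto using typed_id).
have hg1 : typed (src n1 ++ v1) (tgt n1 ++ v1) (g1 ⊠ T v1).
  apply: typed_tens; eauto using typed_id.
(* Rebracketing gives all four layers the common left factor [T u2]. What remains is the interchange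
   of [g2] with [T m ⊠ (g1 ⊠ T v1)]. *)
have e1 : T (u2 ++ src n2 ++ m) ⊠ (g1 ⊠ T v1)
   = T u2 ⊠ (T (src n2) ⊠ (T m ⊠ (g1 ⊠ T v1))).
  rewrite -!id_tens (tens_tensA (typed_id (src n2)) (typed_id m) hg1).
  by rewrite (tens_tensA (typed_id u2) (typed_tens (typed_id (src n2)) (typed_id m) eq_refl eq_refl) hg1).
have e4 : T (u2 ++ tgt n2 ++ m) ⊠ (g1 ⊠ T v1)
   = T u2 ⊠ (T (tgt n2) ⊠ (T m ⊠ (g1 ⊠ T v1))).
  rewrite -!id_tens (tens_tensA (typed_id (tgt n2)) (typed_id m) hg1).
  by rewrite (tens_tensA (typed_id u2) (typed_tens (typed_id (tgt n2)) (typed_id m) eq_refl eq_refl) hg1).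
rewrite /= -!app_assoc in hL *.
rewrite e1 e4.
rewrite -(comp_compA ho1 ho2 hL) -(comp_compA ho3 ho4 hL); congr (_ ∘ _).
rewrite (comp_tens_r u2 (typed_tens (typed_id _) hm eq_refl eq_refl)
           (typed_tens h2 (typed_id _) eq_refl eq_refl)).
rewrite (comp_tens_r u2 (typed_tens h2 (typed_id _) eq_refl eq_refl)
   (typed_tens (typed_id _) hm eq_refl eq_refl)).
by rewrite -(tens_split h2 hm) -(tens_split' h2 hm).
Qed.

(** Insertion sort in which [lswap] plays the role of the comparison: a box lying further to the
    left is moved to an earlier height. *)
Fixpoint linsert (l : layer) (ls : list layer) : list layer :=
  match ls with
  | [] => [l]
  | m :: ls' =>
      match lswap l m with
      | Some (m', l') => m' :: linsert l' ls'
      | None => l :: ls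
      end
  end.

Lemma linsert_sound l ls w w' : chain w (l :: ls) w' ->
  chain w (linsert l ls) w' /\ lsden w (linsert l ls) = lsden w (l :: ls).
Proof.
elim: ls l w => [|m ls IH] l w; first by [].
move=> h; cbn [linsert]; case e: lswap => [[m' l']|] //.
case: (lswap_sound e h) => {}h ->.
case: h => hw /IH [hc he]; split; first by split.
by move: he; cbn [lsden] => ->.
Qed.

Definition lsort_pass : list layer -> list layer := fold_right linsert [].

Lemma lsort_pass_sound ls w w' : chain w ls w' ->
  chain w (lsort_pass ls) w' /\ lsden w (lsort_pass ls) = lsden w ls.
Proof.
elim: ls w => [|l ls IH] w //= [-> h].
case: (IH _ h) => [hc he].
case: (@linsert_sound l (lsort_pass ls) (lsrc l) w') => [|hc' he']; first by split.
by split=> //; rewrite he' /= he.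
Qed.

(** Each pass preserves the value, so any number of passes is sound; the length is a convenient
    choice, and the result is not claimed to be a normal form. *)
Definition lsort (ls : list layer) := Nat.iter (length ls) lsort_pass ls.

Lemma lsort_sound ls w w' : chain w ls w' -> lsden w (lsort ls) = lsden w ls.
Proof.
rewrite /lsort => h; set n := length ls.
suff: chain w (Nat.iter n lsort_pass ls) w' /\
      lsden w (Nat.iter n lsort_pass ls) = lsden w ls by case.
by elim: n => [|n [hc he]] //=; case: (lsort_pass_sound hc) => ? ->.
Qed.

Definition layer_eq_dec (l l' : layer) : {l = l'} + {l <> l'}.
Proof. by repeat decide equality. Defined.

Definition planar_check (t t' : term) : bool :=
  match layers t, layers t' with
  | Some (a, ls, _), Some (a', ls', _) =>
      if list_nat_eq_dec a a' is left _ then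
        if list_eq_dec layer_eq_dec (lsort ls) (lsort ls') is left _ then true else false
      else false
  | _, _ => false
  end.

Lemma planar_check_sound t t' : planar_check t t' = true -> tden t = tden t'.
Proof.
rewrite /planar_check.
case e: (layers t) => [[[a ls] b]|] //; case e': (layers t') => [[[a' ls'] b']|] //.
case: list_nat_eq_dec => // ea; subst a'; case: list_eq_dec => // es _.
case: (layers_sound e) (layers_sound e') => [c ->] [c' ->].
by rewrite -(lsort_sound c) -(lsort_sound c') es.
Qed.

End Strings.

Lemma braid_hom (B : braided_data) (B_br : strict_braided B) (X Y : ob B) :
  isob X -> isob Y -> hom (X ⊗ Y) (Y ⊗ X) (braid X Y).
Proof. by move=> hX hY; case: (braid_iso B_br hX hY). Qed.

(** * Reification *)

Ltac add_new x l :=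
  lazymatch l with
  | context [cons x _] => l
  | _ => constr:(cons x l)
  end.

Ltac index x l :=
  lazymatch l with
  | cons x _ => constr:(O)
  | cons _ ?l => let n := index x l in constr:(S n)
  end.

Ltac ob_atoms X l :=
  lazymatch X with
  | @unit_ob _ => l
  | ?A ⊗ ?B => let l := ob_atoms A l in ob_atoms B l
  | _ => add_new X l
  end.

Ltac reify_ob X l :=
  lazymatch X with
  | @unit_ob _ => constr:(OUnit)
  | ?A ⊗ ?B =>
      let a := reify_ob A l in
      let b := reify_ob B l in
      constr:(OTens a b)
  | _ => let n := index X l in constr:(OAtom n)
  end.

(* [sym] tells whether a braiding is read as [TBraid] or as a generator. *)
Ltac arr_atoms sym t l :=
  lazymatch t with
  | idm ?X => ob_atoms X l
  | ?g ∘ ?f => let l := arr_atoms sym f l in arr_atoms sym g l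
  | ?f ⊠ ?g => let l := arr_atoms sym f l in arr_atoms sym g l
  | braid ?X ?Y => let l := ob_atoms X l in ob_atoms Y l
  | _ =>
      lazymatch goal with
      | _ : hom ?X ?Y t |- _ => let l := ob_atoms X l in ob_atoms Y l
      end
  end.

Ltac arr_gens sym t l gs :=
  lazymatch t with
  | idm _ => gs
  | ?g ∘ ?f => let gs := arr_gens sym f l gs in arr_gens sym g l gs
  | ?f ⊠ ?g => let gs := arr_gens sym f l gs in arr_gens sym g l gs
  | _ =>
      lazymatch gs with
      | context [Gen t _ _] => gs
      | _ =>
          lazymatch t with
          | braid ?X ?Y =>
              lazymatch sym with
              | true => gs
              | false =>
                  let x := reify_ob X l in
                  let y := reify_ob Y l in
                  constr:(cons (Gen t (OTens x y) (OTens y x)) gs)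
              end
          | _ =>
              lazymatch goal with
              | _ : hom ?X ?Y t |- _ =>
                  let x := reify_ob X l in
                  let y := reify_ob Y l in
                  constr:(cons (Gen t x y) gs)
              end
          end
      end
  end.

Ltac gen_index t gs :=
  lazymatch gs with
  | cons (Gen t _ _) _ => constr:(O)
  | cons _ ?gs => let n := gen_index t gs in constr:(S n)
  end.

Ltac reify_arr sym t l gs :=
  lazymatch t with
  | idm ?X => let x := reify_ob X l in constr:(TId x)
  | ?g ∘ ?f =>
      let g := reify_arr sym g l gs in
      let f := reify_arr sym f l gs in
      constr:(TComp g f)
  | ?f ⊠ ?g =>
      let f := reify_arr sym f l gs in
      let g := reify_arr sym g l gs in
      constr:(TTens f g)
  | braid ?X ?Y =>
      lazymatch sym with
      | true =>
          let x := reify_ob X l in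
          let y := reify_ob Y l in
          constr:(TBraid x y)
      | false => let n := gen_index t gs in constr:(TGen n)
      end
  | _ => let n := gen_index t gs in constr:(TGen n)
  end.

Ltac isobs hM :=
  repeat first [assumption | apply: (unit_isob hM) | apply: (tens_isob hM)].

Ltac forall_list :=
  repeat first [apply: Forall_nil | apply: Forall_cons].

Ltac atoms_ok hM := forall_list; isobs hM.

Ltac gens_ok hB :=
  let hM := constr:(br_strict_monoidal hB) in
  forall_list; rewrite /gen_typed /=;
  first [assumption | apply: (braid_hom hB); isobs hM].

(** The types of opaque arrows are read off [hom] hypotheses, and atoms are discharged by [isob]
    hypotheses. This is why the proofs below put such facts into the context before calling the
    tactic. *)
Ltac planar :=
  lazymatch goal with
  | hB : strict_braided ?B |- ?s = ?t =>
      let hM := constr:(br_strict_monoidal hB) in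
      let l := arr_atoms false s (@nil (ob B)) in
      let l := arr_atoms false t l in
      let gs := arr_gens false s l (@nil (gen B)) in
      let gs := arr_gens false t l gs in
      let s' := reify_arr false s l gs in
      let t' := reify_arr false t l gs in
      refine (@planar_check_sound B hM l gs (@braid B) _ _ s' t' _);
      [atoms_ok hM | gens_ok hB | vm_compute; reflexivity]
  end.

Ltac homs :=
  lazymatch goal with
  | hB : strict_braided ?B |- hom ?X ?Y ?t =>
      let hM := constr:(br_strict_monoidal hB) in
      let l := ob_atoms X (@nil (ob B)) in
      let l := ob_atoms Y l in
      let l := arr_atoms true t l in
      let gs := arr_gens true t l (@nil (gen B)) in
      let x := reify_ob X l in
      let y := reify_ob Y l in
      let t' := reify_arr true t l gs in
      refine (@type_check_sound B hM l gs (@braid B) _ _ _ t' x y _);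
      [atoms_ok hM | gens_ok hB | exact (braid_hom hB) | vm_compute; reflexivity]
  end.

(** * Duality in braided categories *)

Section BraidedDuality.

Variables (B : braided_data) (B_br : strict_braided B).

Lemma transpose_hom (X Xs Y Ys : ob B) (dX bX dY bY f : arr B) :
  is_duality X Xs dX bX -> is_duality Y Ys dY bY -> hom X Y f ->
  hom Ys Xs (transpose Xs bX Ys dY f).
Proof. by case=> ? ? ? ? _ _ [? ? ? ? _ _] hf; rewrite /transpose; homs. Qed.

Lemma transpose_idm (X Xs : ob B) (dX bX : arr B) :
  is_duality X Xs dX bX -> transpose Xs bX Xs dX X = Xs.
Proof. 
case=> ? ? ? ? _ e; rewrite -[RHS]e /transpose; planar.
Qed.

Lemma transpose_comp (X Xs Y Ys Z Zs : ob B) (dX bX dY bY dZ bZ f g : arr B) :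
  is_duality X Xs dX bX -> is_duality Y Ys dY bY -> is_duality Z Zs dZ bZ ->
  hom X Y f -> hom Y Z g ->
  transpose Xs bX Zs dZ (g ∘ f) =
  transpose Xs bX Ys dY f ∘ transpose Ys bY Zs dZ g.
Proof.
case=> ? ? ? ? _ _ [? ? ? ? e _] [? ? ? ? _ _] hf hg; rewrite /transpose.
(* An identity of [Y] is exposed between [f] and [g], to be replaced by the snake of [Y]. *)
transitivity ((dZ ⊠ Xs) ∘ (Zs ⊠ g ⊠ Xs) ∘ (Zs ⊠ Y ⊠ Xs) ∘ (Zs ⊠ f ⊠ Xs) ∘ (Zs ⊠ bX)).
  planar.
rewrite -[idm Y]e; planar.
Qed.

Lemma transpose_tens (X Xs Y Ys X' Xs' Y' Ys' : ob B)
    (dX bX dY bY dX' bX' dY' bY' f g : arr B) :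
  is_duality X Xs dX bX -> is_duality Y Ys dY bY ->
  is_duality X' Xs' dX' bX' -> is_duality Y' Ys' dY' bY' ->
  hom X X' f -> hom Y Y' g ->
  transpose (Ys ⊗ Xs) ((X ⊠ bY ⊠ Xs) ∘ bX) (Ys' ⊗ Xs') (dY' ∘ (Ys' ⊠ dX' ⊠ Y'))
    (f ⊠ g) =
  transpose Ys bY Ys' dY' g ⊠ transpose Xs bX Xs' dX' f.
Proof.
case=> ? ? ? ? _ _ [? ? ? ? _ _] [? ? ? ? _ _] [? ? ? ? _ _] hf hg.
rewrite /transpose; planar.
Qed.

Lemma tens_duality (X Xs Y Ys : ob B) (dX bX dY bY : arr B) :
  is_duality X Xs dX bX -> is_duality Y Ys dY bY ->
  is_duality (X ⊗ Y) (Ys ⊗ Xs) (dY ∘ (Ys ⊠ dX ⊠ Y)) ((X ⊠ bY ⊠ Xs) ∘ bX).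
Proof.
case=> ? ? ? ? eX eX' [? ? ? ? eY eY'].
split; [by isobs (br_strict_monoidal B_br)..|homs|homs| |].
(* The two snakes are nested; interchange pulls them apart into a tensor product. *)
- transitivity (((X ⊠ dX) ∘ (bX ⊠ X)) ⊠ ((Y ⊠ dY) ∘ (bY ⊠ Y))); last first.
    by rewrite eX eY; planar.
  transitivity ((X ⊠ Y ⊠ dY) ∘ (X ⊠ bY ⊠ Y) ∘ (((X ⊠ dX) ∘ (bX ⊠ X)) ⊠ Y)); planar.
- transitivity (((dY ⊠ Ys) ∘ (Ys ⊠ bY)) ⊠ ((dX ⊠ Xs) ∘ (Xs ⊠ bX))); last first.
    by rewrite eX' eY'; planar.
  planar.
Qed.

(** Together with [transpose_coev]: transposition exchanges d_X and b_{X^*}, so evaluations and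
    coevaluations are fixed by double transposition and are morphisms of ribbon objects. *)
Lemma transpose_ev (X Xs : ob B) (d b d' b' : arr B) :
  is_duality X Xs d b -> is_duality Xs X d' b' ->
  transpose (Xs ⊗ X) ((Xs ⊠ b ⊠ X) ∘ b') unit_ob unit_ob d = b'.
Proof.
case=> ? ? ? ? _ e [_ _ ? ? _ _]; rewrite /transpose.
transitivity ((((d ⊠ Xs) ∘ (Xs ⊠ b)) ⊠ X) ∘ b'); first planar.
by rewrite e; planar.
Qed.

Lemma transpose_coev (X Xs : ob B) (d b d' b' : arr B) :
  is_duality X Xs d b -> is_duality Xs X d' b' ->
  transpose unit_ob unit_ob (Xs ⊗ X) (d ∘ (Xs ⊠ d' ⊠ X)) b' = d.
Proof.
case=> ? ? ? ? _ _ [_ _ ? ? _ e]; rewrite /transpose.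
transitivity (d ∘ (Xs ⊠ ((d' ⊠ X) ∘ (X ⊠ b')))); first planar.
by rewrite e; planar.
Qed.

Lemma iso_idempotent (X : ob B) (f : arr B) : is_iso X X f -> f ∘ f = f -> f = X.
Proof.
case=> hf [g [hg [e _]]] ff.
have [hX _] := hom_isob (mon_category (br_strict_monoidal B_br)) hf.
transitivity ((g ∘ f) ∘ f); first by rewrite e; planar.
transitivity (g ∘ (f ∘ f)); first planar.
by rewrite ff.
Qed.

(** The hexagon for I ⊗ I = I makes this braiding idempotent, and an invertible idempotent is an
    identity. *)
Lemma braid_unit_l (X : ob B) : isob X -> braid unit_ob X = X.
Proof.
move=> hX; have hI := unit_isob (br_strict_monoidal B_br).
have e1 := tens_ob_unitl (br_strict_monoidal B_br).
have e2 := tens_ob_unitr (br_strict_monoidal B_br).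
have := braid_iso B_br hI hX; rewrite e1 // e2 // => h.
apply: (iso_idempotent h).
have := braid_tensl B_br hI hI hX; rewrite e1 // => e; rewrite [RHS]e; planar.
Qed.

Lemma braid_unit_r (X : ob B) : isob X -> braid X unit_ob = X.
Proof.
move=> hX; have hI := unit_isob (br_strict_monoidal B_br).
have e1 := tens_ob_unitl (br_strict_monoidal B_br).
have e2 := tens_ob_unitr (br_strict_monoidal B_br).
have := braid_iso B_br hX hI; rewrite e1 // e2 // => h.
apply: (iso_idempotent h).
have := braid_tensr B_br hX hI hI; rewrite e1 // => e; rewrite [RHS]e; planar.
Qed.

(** Naturality at d_X and at d_Y, with trivial braidings at the unit, turns both crossings into the
    same arrow [k], the inverse of the braiding of X with Y^*. *)
Lemma ev_braid (X Xs Y Ys : ob B) (dX bX dY bY : arr B) :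
  is_duality X Xs dX bX -> is_duality Y Ys dY bY ->
  dX ∘ (Xs ⊠ dY ⊠ X) ∘ (Xs ⊠ Ys ⊠ braid X Y) =
  dY ∘ (Ys ⊠ dX ⊠ Y) ∘ (braid Xs Ys ⊠ X ⊠ Y).
Proof.
case=> hX hXs ? ? _ _ [hY hYs ? ? _ _].
have hM := br_strict_monoidal B_br; have hI := unit_isob hM.
have hidX := idm_hom (mon_category hM) hX.
have hidYs := idm_hom (mon_category hM) hYs.
case: (braid_iso B_br hX hYs) => _ [k [hk [e1 e2]]].
have E1 : (Ys ⊠ dX) ∘ (braid Xs Ys ⊠ X) = (dX ⊠ Ys) ∘ (Xs ⊠ k).
  transitivity ((Ys ⊠ dX) ∘ (braid Xs Ys ⊠ X) ∘ (Xs ⊠ (braid X Ys ∘ k))).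
    by rewrite e2; planar.
  transitivity ((braid unit_ob Ys ∘ (dX ⊠ Ys)) ∘ (Xs ⊠ k)).
    rewrite (braid_nat B_br (X := Xs ⊗ X) (Y := Ys) (X' := unit_ob) (Y' := Ys)) //.
    rewrite (braid_tensl B_br) //; planar.
  by rewrite (braid_unit_l hYs); planar.
have E2 : (dY ⊠ X) ∘ (Ys ⊠ braid X Y) = (X ⊠ dY) ∘ (k ⊠ Y).
  transitivity ((dY ⊠ X) ∘ (Ys ⊠ braid X Y) ∘ ((braid X Ys ∘ k) ⊠ Y)).
    by rewrite e2; planar.
  transitivity ((braid X unit_ob ∘ (X ⊠ dY)) ∘ (k ⊠ Y)).
    rewrite (braid_nat B_br (X := X) (Y := Ys ⊗ Y) (X' := X) (Y' := unit_ob)) //.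
    rewrite (braid_tensr B_br) //; planar.
  by rewrite (braid_unit_r hX); planar.
transitivity (dX ∘ (Xs ⊠ ((dY ⊠ X) ∘ (Ys ⊠ braid X Y)))); first planar.
transitivity (dY ∘ (((Ys ⊠ dX) ∘ (braid Xs Ys ⊠ X)) ⊠ Y)); last planar.
rewrite E1 E2; planar.
Qed.

(** [ev_braid] moves the crossing through the evaluation of X ⊗ Y; the snake of X ⊗ Y then
    straightens. *)
Lemma transpose_braid (X Xs Y Ys : ob B) (dX bX dY bY : arr B) :
  is_duality X Xs dX bX -> is_duality Y Ys dY bY ->
  transpose (Ys ⊗ Xs) ((X ⊠ bY ⊠ Xs) ∘ bX) (Xs ⊗ Ys) (dX ∘ (Xs ⊠ dY ⊠ X))
    (braid X Y) = braid Xs Ys.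
Proof.
move=> hX hY; have E := ev_braid hX hY.
have e := duality_dual_snake (tens_duality hX hY).
case: hX hY => ? ? ? ? _ _ [? ? ? ? _ _]; rewrite /transpose.
transitivity (((dX ∘ (Xs ⊠ dY ⊠ X) ∘ (Xs ⊠ Ys ⊠ braid X Y)) ⊠ (Ys ⊗ Xs))
   ∘ (Xs ⊠ Ys ⊠ ((X ⊠ bY ⊠ Xs) ∘ bX))); first planar.
rewrite E.
transitivity (((dY ∘ (Ys ⊠ dX ⊠ Y)) ⊠ (Ys ⊗ Xs) ∘
  (Ys ⊗ Xs) ⊠ ((X ⊠ bY ⊠ Xs) ∘ bX)) ∘ braid Xs Ys); first planar.
rewrite e; planar.
Qed.

(** * Curls as partial traces *)

(** [rtrace] closes the strand X on the right of f : P ⊗ X -> Q ⊗ X, and [ltrace] closes it on the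
    left of f : X ⊗ P -> X ⊗ Q. The curls are the partial traces of [braid X X]. *)
Definition rtrace (P Q X Xs : ob B) (b d f : arr B) : arr B :=
  (Q ⊠ d) ∘ (f ⊠ Xs) ∘ (P ⊠ b).

Definition ltrace (P Q X Xs : ob B) (d b f : arr B) : arr B :=
  (d ⊠ Q) ∘ (Xs ⊠ f) ∘ (b ⊠ P).

Lemma curlR_hom (X Xs : ob B) (b d : arr B) :
  isob X -> isob Xs -> hom unit_ob (X ⊗ Xs) b -> hom (X ⊗ Xs) unit_ob d ->
  hom X X (curlR X Xs b d).
Proof. by move=> *; rewrite /curlR; homs. Qed.

Lemma curlL_hom (X Xs : ob B) (b d : arr B) :
  isob X -> isob Xs -> hom unit_ob (Xs ⊗ X) b -> hom (Xs ⊗ X) unit_ob d ->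
  hom X X (curlL X Xs d b).
Proof. by move=> *; rewrite /curlL; homs. Qed.

(** The self-crossing of Y is isolated, so that closing Y produces its curl at once, while
    [braid X (X ⊗ Y)] stays whole for naturality. [braid_double'] does the same for the left trace,
    where X is closed first. *)
Lemma braid_double (X Y : ob B) : isob X -> isob Y ->
  braid (X ⊗ Y) (X ⊗ Y) =
  (braid X (X ⊗ Y) ⊠ Y) ∘ (X ⊠ X ⊠ braid Y Y) ∘ (X ⊠ braid Y X ⊠ Y).
Proof.
move=> hX hY; have hM := br_strict_monoidal B_br.
have hXY := tens_isob hM hX hY.
rewrite (braid_tensl B_br) // (braid_tensr B_br (X := Y)) //; planar.
Qed.

Lemma braid_double' (X Y : ob B) : isob X -> isob Y ->
  braid (X ⊗ Y) (X ⊗ Y) =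
  (X ⊠ braid (X ⊗ Y) Y) ∘ (braid X X ⊠ Y ⊠ Y) ∘ (X ⊠ braid Y X ⊠ Y).
Proof.
move=> hX hY; have hM := br_strict_monoidal B_br.
have hXY := tens_isob hM hX hY.
rewrite (braid_tensr B_br) // (braid_tensl B_br (X := X) (Y := Y) (Z := X)) //; planar.
Qed.

Lemma curlR_tens (X Xs Y Ys : ob B) (bX dX bY dY : arr B) :
  isob X -> isob Xs -> isob Y -> isob Ys ->
  hom unit_ob (X ⊗ Xs) bX -> hom (X ⊗ Xs) unit_ob dX ->
  hom unit_ob (Y ⊗ Ys) bY -> hom (Y ⊗ Ys) unit_ob dY ->
  curlR (X ⊗ Y) (Ys ⊗ Xs) ((X ⊠ bY ⊠ Xs) ∘ bX) (dX ∘ (X ⊠ dY ⊠ Xs)) =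
  (curlR X Xs bX dX ⊠ curlR Y Ys bY dY) ∘ braid Y X ∘ braid X Y.
Proof.
move=> hX hXs hY hYs ? ? ? ?.
have hM := br_strict_monoidal B_br; have hXY := tens_isob hM hX hY.
have hcX : hom X X (curlR X Xs bX dX) by apply: curlR_hom.
have hcY : hom Y Y (curlR Y Ys bY dY) by apply: curlR_hom.
have hidX := idm_hom (mon_category hM) hX.
have hidY := idm_hom (mon_category hM) hY.
have hbYX := braid_hom B_br hY hX.
set cX := curlR X Xs bX dX in hcX *; set cY := curlR Y Ys bY dY in hcY *.
(* The strand Y lies inside the loop of X and is closed first; it contributes [cY]. *)
transitivity (rtrace (X ⊗ Y) (X ⊗ Y) X Xs bX dX
  (braid X (X ⊗ Y) ∘ (X ⊠ (X ⊠ cY)) ∘ (X ⊠ braid Y X))).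
  rewrite /curlR (braid_double hX hY) /rtrace /cY /curlR; planar.
(* Naturality carries [X ⊠ cY] and [braid Y X] past the crossing with X. They leave the loop, in
   which only [braid X X] remains between crossings of X and Y. *)
have -> : braid X (X ⊗ Y) ∘ (X ⊠ (X ⊠ cY)) ∘ (X ⊠ braid Y X) =
  ((X ⊠ cY) ⊠ X) ∘ (braid Y X ⊠ X) ∘ (Y ⊠ braid X X) ∘ (braid X Y ⊠ X).
  have hXc : hom (X ⊗ Y) (X ⊗ Y) (X ⊠ cY) by homs.
  rewrite (braid_nat B_br hidX hXc).
  transitivity (((X ⊠ cY) ⊠ X) ∘ (braid X (X ⊗ Y) ∘ (X ⊠ braid Y X))); first planar.
  rewrite (braid_nat B_br hidX hbYX) (braid_tensr B_br) //; planar.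
transitivity ((X ⊠ cY) ∘ braid Y X ∘ (Y ⊠ cX) ∘ braid X Y).
  rewrite /rtrace /cX /curlR; planar.
transitivity ((X ⊠ cY) ∘ (braid Y X ∘ (Y ⊠ cX)) ∘ braid X Y); first planar.
rewrite (braid_nat B_br hidY hcX); planar.
Qed.

(** Mirror image of [curlR_tens]: here X is the inner loop, and naturality is used in the first
    argument of the braiding. *)
Lemma curlL_tens (X Xs Y Ys : ob B) (bX dX bY dY : arr B) :
  isob X -> isob Xs -> isob Y -> isob Ys ->
  hom unit_ob (Xs ⊗ X) bX -> hom (Xs ⊗ X) unit_ob dX ->
  hom unit_ob (Ys ⊗ Y) bY -> hom (Ys ⊗ Y) unit_ob dY ->
  curlL (X ⊗ Y) (Ys ⊗ Xs) (dY ∘ (Ys ⊠ dX ⊠ Y)) ((Ys ⊠ bX ⊠ Y) ∘ bY) =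
  (curlL X Xs dX bX ⊠ curlL Y Ys dY bY) ∘ braid Y X ∘ braid X Y.
Proof.
move=> hX hXs hY hYs ? ? ? ?.
have hM := br_strict_monoidal B_br; have hXY := tens_isob hM hX hY.
have hcX : hom X X (curlL X Xs dX bX) by apply: curlL_hom.
have hcY : hom Y Y (curlL Y Ys dY bY) by apply: curlL_hom.
have hidX := idm_hom (mon_category hM) hX.
have hidY := idm_hom (mon_category hM) hY.
have hbYX := braid_hom B_br hY hX.
set cX := curlL X Xs dX bX in hcX *; set cY := curlL Y Ys dY bY in hcY *.
transitivity (ltrace (X ⊗ Y) (X ⊗ Y) Y Ys dY bY
  (braid (X ⊗ Y) Y ∘ ((cX ⊠ Y) ⊠ Y) ∘ (braid Y X ⊠ Y))).
  rewrite /curlL (braid_double' hX hY) /ltrace /cX /curlL; planar.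
have -> : braid (X ⊗ Y) Y ∘ ((cX ⊠ Y) ⊠ Y) ∘ (braid Y X ⊠ Y) =
  (Y ⊠ (cX ⊠ Y)) ∘ (Y ⊠ braid Y X) ∘ (braid Y Y ⊠ X) ∘ (Y ⊠ braid X Y).
  have hcY' : hom (X ⊗ Y) (X ⊗ Y) (cX ⊠ Y) by homs.
  rewrite (braid_nat B_br hcY' hidY).
  transitivity ((Y ⊠ (cX ⊠ Y)) ∘ (braid (X ⊗ Y) Y ∘ (braid Y X ⊠ Y))); first planar.
  rewrite (braid_nat B_br hbYX hidY) (braid_tensl B_br) //; planar.
transitivity ((cX ⊠ Y) ∘ braid Y X ∘ (cY ⊠ X) ∘ braid X Y).
  rewrite /ltrace /cY /curlL; planar.
transitivity ((cX ⊠ Y) ∘ (braid Y X ∘ (cY ⊠ X)) ∘ braid X Y); first planar.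
rewrite (braid_nat B_br hcY hidX); planar.
Qed.

(** The self-braiding of X^* is written as the transpose of that of X. The loop then differs from
    the transposed left curl by one snake of X. *)
Lemma curlR_dual (X Xs : ob B) (d b d' b' : arr B) :
  is_duality X Xs d b -> is_duality Xs X d' b' ->
  curlR Xs X b' d = transpose Xs b Xs d (curlL X Xs d b').
Proof.
move=> hX [_ _ ? ? _ _].
rewrite /curlR -(transpose_braid hX hX).
case: hX => ? ? ? ? e _; rewrite /curlL /transpose.
transitivity (((d ∘ (Xs ⊠ d ⊠ X)) ⊠ Xs) ∘ (Xs ⊠ Xs ⊠ braid X X ⊠ Xs) ∘
  (Xs ⊠ ((Xs ⊠ ((X ⊠ d) ∘ (b ⊠ X))) ∘ b') ⊠ X ⊠ Xs) ∘ (Xs ⊠ b)).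
  planar.
rewrite e; planar.
Qed.

Lemma curlL_dual (X Xs : ob B) (d b d' b' : arr B) :
  is_duality X Xs d b -> is_duality Xs X d' b' ->
  curlL Xs X d' b = transpose Xs b Xs d (curlR X Xs b d').
Proof.
move=> hX [_ _ ? ? _ _].
rewrite /curlL -(transpose_braid hX hX).
case: hX => ? ? ? ? e _; rewrite /curlR /transpose.
transitivity ((d' ⊠ Xs) ∘ (((X ⊠ d) ∘ (b ⊠ X)) ⊠ Xs ⊠ Xs) ∘
  (d ⊠ X ⊠ Xs ⊠ Xs) ∘ (Xs ⊠ braid X X ⊠ Xs ⊠ Xs) ∘
  (Xs ⊠ ((X ⊠ b ⊠ Xs) ∘ b))).
  planar.
rewrite e; planar.
Qed.

End BraidedDuality.

(** * The category of ribbon objects *)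

Section RibbonCategory.

Variables (B : braided_data) (B_br : strict_braided B).

Let B_mon := br_strict_monoidal B_br.
Let B_cat := mon_category B_mon.

Lemma ribbon_isob (X : piv_data B) : is_ribbon X -> isob (pv_ob X).
Proof. by case=> [[[]]]. Qed.

Lemma ribbon_dual (X : piv_data B) : is_ribbon X -> is_ribbon (piv_dual X).
Proof.
case=> [[h h'] c]; split; first by split.
by rewrite /= (curlR_dual B_br h h') (curlL_dual B_br h h') c.
Qed.

Lemma ribbon_unit : is_ribbon (piv_unit B).
Proof.
have hI := unit_isob B_mon; have hidI := idm_hom B_cat hI.
have h : is_duality (unit_ob : ob B) unit_ob unit_ob unit_ob.
  by split=> //; try homs; planar.
split; first by split.
by rewrite /= /curlR /curlL (braid_unit_l B_br hI).
Qed.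

Lemma ribbon_tens (X Y : piv_data B) :
  is_ribbon X -> is_ribbon Y -> is_ribbon (piv_tens X Y).
Proof.
case=> [[hX hX'] cX] [[hY hY'] cY].
split; first by split; apply: tens_duality.
case: hX cX hX' => ? ? ? ? _ _ cX [_ _ ? ? _ _].
case: hY cY hY' => ? ? ? ? _ _ cY [_ _ ? ? _ _].
by rewrite /= (curlR_tens B_br) // (curlL_tens B_br) // cX cY.
Qed.

Lemma piv_transpose_hom (X Y : piv_data B) (f : arr B) :
  is_ribbon X -> is_ribbon Y -> hom (pv_ob X) (pv_ob Y) f ->
  hom (pv_dual Y) (pv_dual X) (piv_transpose X Y f).
Proof. by move=> [[hX _] _] [[hY _] _]; exact: (transpose_hom B_br hX hY). Qed.

Lemma piv_bitranspose_idm (X : piv_data B) : is_ribbon X ->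
  piv_bitranspose X X (pv_ob X) = pv_ob X.
Proof.
move=> [[h h'] _]; rewrite /piv_bitranspose /piv_transpose.
by rewrite (transpose_idm B_br h) (transpose_idm B_br h').
Qed.

Lemma piv_bitranspose_comp (X Y Z : piv_data B) (f g : arr B) :
  is_ribbon X -> is_ribbon Y -> is_ribbon Z ->
  hom (pv_ob X) (pv_ob Y) f -> hom (pv_ob Y) (pv_ob Z) g ->
  piv_bitranspose X Z (g ∘ f) = piv_bitranspose Y Z g ∘ piv_bitranspose X Y f.
Proof.
move=> rX rY rZ hf hg; have hf' := piv_transpose_hom rX rY hf.
have hg' := piv_transpose_hom rY rZ hg.
case: rX rY rZ => [[hX hX'] _] [[hY hY'] _] [[hZ hZ'] _].
rewrite /piv_bitranspose {1}/piv_transpose (transpose_comp B_br hX hY hZ hf hg).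
exact: (transpose_comp B_br hZ' hY' hX' hg' hf').
Qed.

Lemma ribbon_mor_idm (X : piv_data B) :
  is_ribbon X -> is_ribbon_morphism X X (pv_ob X).
Proof.
move=> h; split=> //; first exact: (idm_hom B_cat (ribbon_isob h)).
by rewrite piv_bitranspose_idm.
Qed.

Lemma ribbon_mor_comp (X Y Z : piv_data B) (f g : arr B) :
  is_ribbon_morphism X Y f -> is_ribbon_morphism Y Z g ->
  is_ribbon_morphism X Z (g ∘ f).
Proof.
case=> hX hY hf ef [_ hZ hg eg]; split=> //.
  exact: (comp_hom B_cat hf hg).
by rewrite (piv_bitranspose_comp hX hY hZ hf hg) -ef -eg.
Qed.

Lemma ribbon_mor_tens (X X' Y Y' : piv_data B) (f g : arr B) :
  is_ribbon_morphism X X' f -> is_ribbon_morphism Y Y' g ->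
  is_ribbon_morphism (piv_tens X Y) (piv_tens X' Y') (f ⊠ g).
Proof.
case=> rX rX' hf ef [rY rY' hg eg].
split; [exact: ribbon_tens|exact: ribbon_tens|exact: (tens_hom B_mon hf hg)|].
have hf' := piv_transpose_hom rX rX' hf.
have hg' := piv_transpose_hom rY rY' hg.
case: rX rX' rY rY' => [[hX sX] _] [[hX' sX'] _] [[hY sY] _] [[hY' sY'] _].
(* The second transposition takes place between the duals, where the order of the tensor factors is
   reversed. *)
have e := transpose_tens B_br sY' sX' sY sX hg' hf'.
rewrite {1}ef {1}eg -[LHS]e; congr transpose.
exact: (eq_sym (transpose_tens B_br hX hY hX' hY' hf hg)).
Qed.

Lemma ribbon_mor_braid (X Y : piv_data B) : is_ribbon X -> is_ribbon Y ->
  is_ribbon_morphism (piv_tens X Y) (piv_tens Y X) (braid (pv_ob X) (pv_ob Y)).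
Proof.
move=> rX rY; split; [exact: ribbon_tens|exact: ribbon_tens| |].
  by apply: (braid_hom B_br); apply: ribbon_isob.
case: rX rY => [[hX hX'] _] [[hY hY'] _].
rewrite /piv_bitranspose /piv_transpose /=.
by rewrite (transpose_braid B_br hX hY) (transpose_braid B_br hX' hY').
Qed.

(** Double transposition is functorial and fixes [f], so g^** is again a left inverse of [f], hence
    equal to [g]. *)
Lemma ribbon_mor_inv (X Y : piv_data B) (f g : arr B) :
  is_ribbon_morphism X Y f -> hom (pv_ob Y) (pv_ob X) g ->
  g ∘ f = pv_ob X -> f ∘ g = pv_ob Y -> is_ribbon_morphism Y X g.
Proof.
case=> rX rY hf ef hg gf fg; split=> //.
set g' := piv_bitranspose Y X g.
have hg' : hom (pv_ob Y) (pv_ob X) g'.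
  move: (piv_transpose_hom (ribbon_dual rX) (ribbon_dual rY)
    (piv_transpose_hom rY rX hg)); exact.
have e : g' ∘ f = pv_ob X.
  by rewrite {1}ef -(piv_bitranspose_comp rX rY rX hf hg) gf piv_bitranspose_idm.
rewrite -(comp_idl B_cat hg) -e -(comp_assoc B_cat hg hf hg') fg.
exact: (comp_idr B_cat hg').
Qed.

Lemma ribbon_mor_dual (X Y : piv_data B) (f : arr B) :
  is_ribbon_morphism X Y f ->
  is_ribbon_morphism (piv_dual Y) (piv_dual X) (piv_transpose X Y f).
Proof.
case=> rX rY hf ef; split; [exact: ribbon_dual|exact: ribbon_dual| |].
  exact: piv_transpose_hom.
by rewrite {1}ef.
Qed.

Lemma ribbon_mor_ev (X : piv_data B) : is_ribbon X ->
  is_ribbon_morphism (piv_tens (piv_dual X) X) (piv_unit B) (pv_ev X).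
Proof.
move=> rX; split; [by apply: ribbon_tens => //; exact: ribbon_dual|exact: ribbon_unit| |].
  by case: rX => [[[]]].
case: rX => [[h h'] _]; rewrite /piv_bitranspose /piv_transpose /=.
by rewrite (transpose_ev B_br h h') (transpose_coev B_br h h').
Qed.

Lemma ribbon_mor_coev (X : piv_data B) : is_ribbon X ->
  is_ribbon_morphism (piv_unit B) (piv_tens X (piv_dual X)) (pv_coev X).
Proof.
move=> rX; split; [exact: ribbon_unit|by apply: ribbon_tens => //; exact: ribbon_dual| |].
  by case: rX => [[[]]].
case: rX => [[h h'] _]; rewrite /piv_bitranspose /piv_transpose /=.
by rewrite (transpose_coev B_br h' h) (transpose_ev B_br h' h).
Qed.

Lemma piv_tens_assoc (X Y Z : piv_data B) :
  is_ribbon X -> is_ribbon Y -> is_ribbon Z ->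
  piv_tens X (piv_tens Y Z) = piv_tens (piv_tens X Y) Z.
Proof.
move=> [[[? ? ? ? _ _] [_ _ ? ? _ _]] _] [[[? ? ? ? _ _] [_ _ ? ? _ _]] _].
move=> [[[? ? ? ? _ _] [_ _ ? ? _ _]] _].
rewrite /piv_tens /=; congr PivData; try planar.
  by rewrite (tens_ob_assoc B_mon).
by rewrite (tens_ob_assoc B_mon).
Qed.

Lemma piv_tens_unit_l (X : piv_data B) : is_ribbon X -> piv_tens (piv_unit B) X = X.
Proof.
have hI := unit_isob B_mon.
case: X => X Xs d b d' b' [[[/= ? ? ? ? _ _] [/= _ _ ? ? _ _]] _].
rewrite /piv_tens /=; congr PivData; try planar.
  exact: (tens_ob_unitl B_mon).
exact: (tens_ob_unitr B_mon).
Qed.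

Lemma piv_tens_unit_r (X : piv_data B) : is_ribbon X -> piv_tens X (piv_unit B) = X.
Proof.
have hI := unit_isob B_mon.
case: X => X Xs d b d' b' [[[/= ? ? ? ? _ _] [/= _ _ ? ? _ _]] _].
rewrite /piv_tens /=; congr PivData; try planar.
  exact: (tens_ob_unitr B_mon).
exact: (tens_ob_unitl B_mon).
Qed.

Lemma ribbon_cat_category : category (ribbon_cat B).
Proof.
split=> /=.
- by move=> X Y f [].
- exact: ribbon_mor_idm.
- exact: ribbon_mor_comp.
- by move=> X Y f [_ _ hf _]; exact: (comp_idl B_cat hf).
- by move=> X Y f [_ _ hf _]; exact: (comp_idr B_cat hf).
- by move=> X Y Z W f g h [_ _ hf _] [_ _ hg _] [_ _ hh _]; exact: (comp_assoc B_cat hf hg hh).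
Qed.

Lemma ribbon_cat_monoidal : strict_monoidal (ribbon_cat B).
Proof.
split=> /=.
- exact: ribbon_cat_category.
- exact: ribbon_unit.
- exact: ribbon_tens.
- exact: ribbon_mor_tens.
- move=> X Y hX hY; exact: (tens_idm B_mon (ribbon_isob hX) (ribbon_isob hY)).
- move=> X X' X'' Y Y' Y'' f f' g g' [_ _ h1 _] [_ _ h2 _] [_ _ h3 _] [_ _ h4 _].
  exact: (tens_comp B_mon h1 h2 h3 h4).
- exact: piv_tens_assoc.
- exact: piv_tens_unit_l.
- exact: piv_tens_unit_r.
- move=> X X' Y Y' Z Z' f g h [_ _ h1 _] [_ _ h2 _] [_ _ h3 _].
  exact: (tens_arr_assoc B_mon h1 h2 h3).
- by move=> X Y f [_ _ hf _]; exact: (tens_arr_unitl B_mon hf).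
- by move=> X Y f [_ _ hf _]; exact: (tens_arr_unitr B_mon hf).
Qed.

Lemma ribbon_cat_braided : strict_braided (ribbon_cat B).
Proof.
split=> /=.
- exact: ribbon_cat_monoidal.
- move=> X Y rX rY; split; first exact: ribbon_mor_braid.
  case: (braid_iso B_br (ribbon_isob rX) (ribbon_isob rY)) => _ [g [hg [gf fg]]].
  by exists g; split=> //; apply: (ribbon_mor_inv (ribbon_mor_braid rX rY)).
- move=> X X' Y Y' f g [_ _ hf _] [_ _ hg _]; exact: (braid_nat B_br hf hg).
- move=> X Y Z hX hY hZ.
  exact: (braid_tensl B_br (ribbon_isob hX) (ribbon_isob hY) (ribbon_isob hZ)).
- move=> X Y Z hX hY hZ.
  exact: (braid_tensr B_br (ribbon_isob hX) (ribbon_isob hY) (ribbon_isob hZ)).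
Qed.

Lemma ribbon_cat_pivotal : strict_pivotal (ribbon_cat B) (ribbon_cat_duals B).
Proof.
split=> /=.
- exact: ribbon_cat_monoidal.
- move=> X rX; split=> //=.
  + exact: ribbon_dual.
  + exact: ribbon_mor_ev.
  + exact: ribbon_mor_coev.
  + by case: rX => [[[]]].
  + by case: rX => [[[]]].
- exact: ribbon_mor_dual.
- by move=> X [[h _] _]; exact: (transpose_idm B_br h).
- move=> X Y Z f g [[[hX _] _] [[hY _] _] hf _] [_ [[hZ _] _] hg _].
  exact: (transpose_comp B_br hX hY hZ hf hg).
- by [].
- by [].
- move=> X X' Y Y' f g [[[hX _] _] [[hX' _] _] hf _] [[[hY _] _] [[hY' _] _] hg _].
  exact: (transpose_tens B_br hX hY hX' hY' hf hg).
- by [].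
- by [].
- by [].
- by [].
- by case.
(* The equation f = f^** is part of the definition of a morphism of ribbon objects. *)
- by move=> X Y f [_ _ _ {2}->].
Qed.

Lemma ribbon_cat_ribbon : strict_ribbon (ribbon_cat B) (ribbon_cat_duals B).
Proof.
split.
- exact: ribbon_cat_pivotal.
- exact: ribbon_cat_braided.
- by move=> X [].
Qed.

End RibbonCategory.

(** * Permutations of wires *)

(** The index of an atom, together with a name. Names distinguish wires of the same type, so a
    duplicate-free list determines the permutation leading to any rearrangement of it. *)
Definition wire : Type := nat * list nat.

Definition wire_eq_dec (x y : wire) : {x = y} + {x <> y}.
Proof. by repeat decide equality. Defined.

Fixpoint rem (x : wire) (l : list wire) : list wire :=
  match l with
  | [] => []
  | y :: l => if wire_eq_dec x y is left _ then l else y :: rem x l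
  end.

Lemma rem_head x l : rem x (x :: l) = l.
Proof. by rewrite /=; case: wire_eq_dec. Qed.

Lemma rem_other x y l : x <> y -> rem x (y :: l) = y :: rem x l.
Proof. by rewrite /=; case: wire_eq_dec. Qed.

Lemma rem_perm x l : In x l -> Permutation l (x :: rem x l).
Proof.
elim: l => [|y l IH] //; case: (wire_eq_dec x y) => [->|xy].
  by rewrite rem_head.
case=> [yx|/IH h]; first by case: xy.
rewrite rem_other //; apply: Permutation_trans (perm_swap _ _ _).
exact: perm_skip.
Qed.

Lemma rem_perm_cons x l k : Permutation l (x :: k) ->
  In x l /\ Permutation (rem x l) k.
Proof.
move=> h; have xl : In x l.
  by apply: (Permutation_in x (Permutation_sym h)); left.
split=> //; apply: (Permutation_cons_inv (a := x)).
exact: Permutation_trans (Permutation_sym (rem_perm xl)) h.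
Qed.

Lemma rem_in x y l : x <> y -> In x l -> In x (rem y l).
Proof.
move=> xy; elim: l => [|z l IH] //; case: (wire_eq_dec y z) => [<-|yz].
  by rewrite rem_head => -[e|//]; case: xy.
by rewrite rem_other // => -[->|/IH h]; [left|right].
Qed.

Lemma rem_rem x y l : rem x (rem y l) = rem y (rem x l).
Proof.
case: (wire_eq_dec x y) => [->//|xy].
elim: l => [|z l IH] //.
case: (wire_eq_dec x z) => [<-|xz]; last case: (wire_eq_dec y z) => [<-|yz].
- by rewrite rem_head (rem_other l (not_eq_sym xy)) rem_head.
- by rewrite rem_head (rem_other l xy) rem_head.
- by rewrite (rem_other l yz) (rem_other _ xz) (rem_other l xz) (rem_other _ yz) IH.
Qed.

Lemma rem_app x u v : In x u -> rem x (u ++ v) = rem x u ++ v.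
Proof.
elim: u => [|y u IH] //; rewrite -app_comm_cons.
case: (wire_eq_dec x y) => [<-|xy]; first by rewrite !rem_head.
by rewrite !rem_other // => -[e|/IH ->//]; case: xy.
Qed.

Lemma rem_app_notin x u v : ~ In x u -> rem x (u ++ v) = u ++ rem x v.
Proof.
elim: u => [|y u IH] // h; rewrite -!app_comm_cons rem_other.
  by move=> e; apply: h; left.
by rewrite IH // => h'; apply: h; right.
Qed.

Fixpoint rm (xs l : list wire) : list wire :=
  match xs with
  | [] => l
  | x :: xs => rm xs (rem x l)
  end.

Lemma rm_app xs u v : NoDup xs -> incl xs u -> rm xs (u ++ v) = rm xs u ++ v.
Proof.
elim: xs u => [|x xs IH] u //= /(proj1 (NoDup_cons_iff _ _)) [nx nd] h.
case: (incl_cons_inv h) => xu xsu.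
rewrite (rem_app _ xu) IH // => y hy; apply: rem_in; last exact: xsu.
by move=> e; subst y.
Qed.

Lemma rm_app_disjoint xs u v : (forall x, In x xs -> ~ In x u) ->
  rm xs (u ++ v) = u ++ rm xs v.
Proof.
elim: xs v => [|x xs IH] v //= h.
rewrite rem_app_notin; first by apply: h; left.
by rewrite IH // => y hy; apply: h; right.
Qed.

Lemma rm_self xs v : rm xs (xs ++ v) = v.
Proof. by elim: xs => [|x xs IH] //; rewrite -app_comm_cons; cbn [rm]; rewrite rem_head. Qed.

Lemma rm_perm xs l : NoDup xs -> incl xs l -> Permutation l (xs ++ rm xs l).
Proof.
elim: xs l => [|x xs IH] l //= /(proj1 (NoDup_cons_iff _ _)) [nx nd] h.
case: (incl_cons_inv h) => xl xsl.
apply: Permutation_trans (rem_perm xl) _; apply: perm_skip; apply: IH => // y hy.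
by apply: rem_in; [move=> e; subst y|exact: xsl].
Qed.

Lemma NoDup_app_disjoint (u v : list wire) x : NoDup (u ++ v) -> In x u -> ~ In x v.
Proof.
move=> h /(@in_split _ _ _) [u1 [u2 e]] xv; subst u.
rewrite -app_assoc -app_comm_cons in h.
by apply: (NoDup_remove_2 _ _ _ h); do 2 (apply: in_or_app; right).
Qed.

Section Wires.

Variables (V : braided_data) (V_sym : strict_symmetric V).

Let V_br := sym_strict_braided V_sym.
Let V_mon := br_strict_monoidal V_br.

Variables (atoms : list (ob V)) (gens : list (gen V)).
Hypothesis atoms_isob : Forall (@isob V) atoms.
Hypothesis gens_typed : Forall (gen_typed atoms) gens.

Definition wob (x : wire) : ob V := atom atoms (fst x).

Definition wobs (l : list wire) : ob V := tens_list atoms (map fst l).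

Lemma wob_isob x : isob (wob x).
Proof. exact: (atom_isob V_mon atoms_isob). Qed.

Lemma wobs_isob l : isob (wobs l).
Proof. exact: (tens_list_isob V_mon atoms_isob). Qed.

Lemma wobs_app u v : wobs (u ++ v) = wobs u ⊗ wobs v.
Proof. by rewrite /wobs map_app (tens_list_app V_mon atoms_isob). Qed.

Lemma wobs_cons x l : wobs (x :: l) = wob x ⊗ wobs l.
Proof. by []. Qed.

Lemma wobs_hom l : hom (wobs l) (wobs l) (wobs l).
Proof. exact: (idm_hom (mon_category V_mon) (wobs_isob l)). Qed.

(** Naturality of the braiding with Z at the arrow [braid X Y], expanded by the hexagon. *)
Lemma yang_baxter (X Y Z : ob V) : isob X -> isob Y -> isob Z ->
  (braid Y Z ⊠ X) ∘ (Y ⊠ braid X Z) ∘ (braid X Y ⊠ Z) =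
  (Z ⊠ braid X Y) ∘ (braid X Z ⊠ Y) ∘ (X ⊠ braid Y Z).
Proof.
move=> hX hY hZ; have hXY := braid_hom V_br hX hY.
have hidZ := idm_hom (mon_category V_mon) hZ.
have := braid_nat V_br hXY hidZ.
rewrite !(braid_tensl V_br) // => e.
rewrite {}e; planar.
Qed.

(** Moves [x] to the front across the wires before it, one crossing at a time. *)
Fixpoint pull (x : wire) (l : list wire) : arr V :=
  match l with
  | [] => unit_ob
  | y :: l' =>
      if wire_eq_dec x y is left _ then wobs l
      else (braid (wob y) (wob x) ⊠ wobs (rem x l')) ∘ (wob y ⊠ pull x l')
  end.

(** The canonical symmetry carrying the arrangement [l] to [l'], written as a selection sort: the
    first wire wanted is pulled to the front, then the others are arranged. *)
Fixpoint can (l l' : list wire) : arr V :=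
  match l' with
  | [] => unit_ob
  | x :: k => (wob x ⊠ can (rem x l) k) ∘ pull x l
  end.

Lemma pull_head x l : pull x (x :: l) = wobs (x :: l).
Proof. by rewrite /=; case: wire_eq_dec. Qed.

Lemma pull_other x y l : x <> y -> pull x (y :: l) =
  (braid (wob y) (wob x) ⊠ wobs (rem x l)) ∘ (wob y ⊠ pull x l).
Proof. by rewrite /=; case: wire_eq_dec. Qed.

Lemma pull_hom x l : In x l ->
  hom (wobs l) (wob x ⊗ wobs (rem x l)) (pull x l).
Proof.
elim: l => [|y l IH] //; have hx := wob_isob x; have hy := wob_isob y.
have hr := wobs_isob (rem x l); have hl := wobs_isob l.
case: (wire_eq_dec x y) => [<-|xy].
  by move=> _; rewrite rem_head pull_head -wobs_cons; exact: wobs_hom.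
case=> [yx|/IH h]; first by case: xy.
by rewrite rem_other // pull_other // !wobs_cons; homs.
Qed.

Lemma can_hom l l' : Permutation l l' -> hom (wobs l) (wobs l') (can l l').
Proof.
elim: l' l => [|x k IH] l.
  by move/Permutation_sym/Permutation_nil ->; exact: (wobs_hom []).
case/rem_perm_cons => xl /IH h; have hp := pull_hom xl.
have hx := wob_isob x; have hr := wobs_isob (rem x l); have hk := wobs_isob k.
by have hl := wobs_isob l; rewrite /= wobs_cons; homs.
Qed.

(** The order of two pulls matters only up to a crossing. If [y] is at the head this is interchange;
    if [x] is, a double crossing cancels by symmetry; otherwise the head wire moves past by the
    Yang-Baxter equation and induction applies. *)
Lemma pull_pull x y l : x <> y -> In x l -> In y l ->
  (braid (wob y) (wob x) ⊠ wobs (rem x (rem y l))) ∘ (wob y ⊠ pull x (rem y l))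
    ∘ pull y l =
  (wob x ⊠ pull y (rem x l)) ∘ pull x l.
Proof.
move=> xy; have hx := wob_isob x; have hy := wob_isob y.
elim: l => [|z l IH] // xl yl.
have hz := wob_isob z; have hl := wobs_isob l.
have h1 := wobs_isob (rem x l); have h2 := wobs_isob (rem y l).
case: (wire_eq_dec y z) xl yl => [<-|yz] xl yl.
  rewrite rem_head pull_head pull_other // rem_other // pull_head !wobs_cons.
  have xl' : In x l by case: xl => // e; case: xy.
  by have hp := pull_hom xl'; planar.
case: (wire_eq_dec x z) xl yl => [<-|xz] xl yl.
  have yx := not_eq_sym xy.
  rewrite rem_head rem_other // rem_head !pull_head pull_other // !wobs_cons.
  have yl' : In y l by case: yl => // e; case: xy.
  have hp := pull_hom yl'.
  transitivity (((braid (wob y) (wob x) ∘ braid (wob x) (wob y)) ⊠ wobs (rem y l))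
    ∘ (wob x ⊠ pull y l)); first planar.
  by rewrite (braid_sym V_sym) //; planar.
have xl' : In x l by case: xl => // e; case: xz.
have yl' : In y l by case: yl => // e; case: yz.
have hpx := pull_hom xl'; have hpy := pull_hom yl'.
have hpxy := pull_hom (rem_in xy xl').
have hpyx := pull_hom (rem_in (not_eq_sym xy) yl').
have {}IH := IH xl' yl'.
rewrite !rem_other // !pull_other // !wobs_cons.
rewrite [rem y (rem x l)]rem_rem in hpyx *.
have h3 := wobs_isob (rem x (rem y l)).
transitivity (((braid (wob y) (wob x) ⊠ wob z ∘ wob y ⊠ braid (wob z) (wob x) ∘
   braid (wob z) (wob y) ⊠ wob x) ⊠ wobs (rem x (rem y l))) ∘
   (wob z ⊠ wob y ⊠ pull x (rem y l)) ∘ (wob z ⊠ pull y l)); first planar.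
rewrite yang_baxter //.
transitivity (((wob x ⊠ braid (wob z) (wob y) ∘ braid (wob z) (wob x) ⊠ wob y)
   ⊠ wobs (rem x (rem y l))) ∘
  (wob z ⊠ (braid (wob y) (wob x) ⊠ wobs (rem x (rem y l)) ∘
    wob y ⊠ pull x (rem y l) ∘ pull y l))); first planar.
rewrite IH; planar.
Qed.

Lemma pull_can x l l' : Permutation l l' -> In x l' ->
  pull x l' ∘ can l l' = (wob x ⊠ can (rem x l) (rem x l')) ∘ pull x l.
Proof.
have hx := wob_isob x.
elim: l' l => [|y k IH] l // /rem_perm_cons [yl h] xk.
have hy := wob_isob y; have hc := can_hom h; have hpy := pull_hom yl.
have ? := wobs_isob l; have ? := wobs_isob k; have ? := wobs_isob (rem y l).
case: (wire_eq_dec x y) xk => [e|xy] xk.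
  by subst y; rewrite pull_head rem_head /= wobs_cons; planar.
have xk' : In x k by case: xk => // e; case: xy.
have xl' : In x (rem y l) by apply: Permutation_in (Permutation_sym h) xk'.
have xl : In x l.
  by apply: Permutation_in (Permutation_sym (rem_perm yl)) _; right.
have hpx := pull_hom xk'; have hpx' := pull_hom xl'; have hpxl := pull_hom xl.
have yl' : In y (rem x l) by apply: rem_in => //; exact: not_eq_sym.
have hpy' := pull_hom yl'.
have hc' : Permutation (rem x (rem y l)) (rem x k).
  apply: (Permutation_cons_inv (a := x)).
  apply: Permutation_trans (Permutation_sym (rem_perm xl')) _.
  exact: Permutation_trans h (rem_perm xk').
have {}hc' := can_hom hc'.
have ? := wobs_isob (rem x k); have ? := wobs_isob (rem x (rem y l)).
have ? := wobs_isob (rem x l).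
rewrite rem_other // pull_other //= rem_rem.
transitivity ((braid (wob y) (wob x) ⊠ wobs (rem x k)) ∘
  (wob y ⊠ (pull x k ∘ can (rem y l) k)) ∘ pull y l); first planar.
rewrite IH //.
transitivity ((wob x ⊠ wob y ⊠ can (rem x (rem y l)) (rem x k)) ∘
 ((braid (wob y) (wob x) ⊠ wobs (rem x (rem y l))) ∘ (wob y ⊠ pull x (rem y l))
    ∘ pull y l)); first planar.
rewrite pull_pull //.
rewrite [rem y (rem x l)]rem_rem in hpy' *.
planar.
Qed.

(** Coherence for permutations. [pull_can] lets the first wire of [l''] be pulled out before the
    first permutation, and induction treats the remaining wires. *)
Lemma can_comp l l' l'' : Permutation l l' -> Permutation l' l'' ->
  can l' l'' ∘ can l l' = can l l''.
Proof.
elim: l'' l l' => [|x k IH] l l' h h'.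
  have h'' := can_hom h; move: h h''.
  move/Permutation_sym/Permutation_nil: h' => -> /= /Permutation_sym/Permutation_nil -> /= h.
  exact: (id_comp V_mon (u := []) h).
case/rem_perm_cons: (h') => xl' h1; case/rem_perm_cons: (Permutation_trans h h') => xl h2.
have h3 : Permutation (rem x l) (rem x l').
  exact: Permutation_trans h2 (Permutation_sym h1).
have hc := can_hom h; have hc1 := can_hom h1; have hc3 := can_hom h3.
have hp := pull_hom xl; have hp' := pull_hom xl'; have hx := wob_isob x.
have ? := wobs_isob l; have ? := wobs_isob l'; have ? := wobs_isob k.
have ? := wobs_isob (rem x l); have ? := wobs_isob (rem x l').
rewrite /= -(IH _ _ h3 h1).
transitivity ((wob x ⊠ can (rem x l') k) ∘ (pull x l' ∘ can l l')); first planar.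
rewrite pull_can //; planar.
Qed.

Lemma can_app_l u l l' : Permutation l l' ->
  can (u ++ l) (u ++ l') = wobs u ⊠ can l l'.
Proof.
move=> h; have hc := can_hom h; have ? := wobs_isob l; have ? := wobs_isob l'.
elim: u => [|x u IH]; first by rewrite /wobs /=; planar.
rewrite -!app_comm_cons; cbn [can]; rewrite rem_head pull_head IH !wobs_cons wobs_app.
have ? := wobs_isob u; have ? := wob_isob x; planar.
Qed.

Lemma can_refl l : can l l = wobs l.
Proof.
have := @can_app_l l [] [] (perm_nil _); rewrite !app_nil_r => ->.
have ? := wobs_isob l; rewrite /=; planar.
Qed.

Lemma pull_app x u v : In x u -> pull x (u ++ v) = pull x u ⊠ wobs v.
Proof.
have hv := wobs_isob v; have hx := wob_isob x.
elim: u => [|y u IH] // xu; rewrite -app_comm_cons.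
have ? := wobs_isob u; have hy := wob_isob y.
case: (wire_eq_dec x y) xu => [<-|xy] xu.
  by rewrite !pull_head !wobs_cons wobs_app; planar.
have xu' : In x u by case: xu => // e; case: xy.
rewrite !pull_other // IH // rem_app // wobs_app.
have ? := wobs_isob (rem x u); have h := pull_hom xu'; planar.
Qed.

Lemma can_app_r v l l' : Permutation l l' ->
  can (l ++ v) (l' ++ v) = can l l' ⊠ wobs v.
Proof.
have ? := wobs_isob v.
elim: l' l => [|x k IH] l.
  by move/Permutation_sym/Permutation_nil ->; rewrite /= can_refl; planar.
case/rem_perm_cons => xl h; rewrite /= pull_app // rem_app // IH //.
have hc := can_hom h; have hp := pull_hom xl; have ? := wob_isob x.
have ? := wobs_isob l; have ? := wobs_isob k; have ? := wobs_isob (rem x l).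
planar.
Qed.

Lemma pull_mid x u v : ~ In x u ->
  pull x (u ++ x :: v) = braid (wobs u) (wob x) ⊠ wobs v.
Proof.
have hv := wobs_isob v; have hx := wob_isob x.
elim: u => [|y u IH] xu.
  rewrite [[] ++ _]/= pull_head wobs_cons (braid_unit_l V_br hx); planar.
have ? := wobs_isob u; have hy := wob_isob y.
rewrite -app_comm_cons pull_other; first by move=> e; apply: xu; left.
have xu' : ~ In x u by move=> h; apply: xu; right.
rewrite IH // rem_app_notin // rem_head wobs_app wobs_cons (braid_tensl V_br) //.
planar.
Qed.

Lemma can_swap u v : NoDup (u ++ v) -> can (u ++ v) (v ++ u) = braid (wobs u) (wobs v).
Proof.
have hu := wobs_isob u.
elim: v => [|x v IH].
  by rewrite app_nil_r can_refl (braid_unit_r V_br hu).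
move=> h; have xu : ~ In x u.
  move=> xu; apply: (NoDup_remove_2 _ _ _ h); apply: in_or_app; by left.
have hv := wobs_isob v; have hx := wob_isob x.
rewrite -app_comm_cons /= pull_mid // rem_app_notin // rem_head IH.
  exact: NoDup_remove_1 h.
rewrite wobs_cons (braid_tensr V_br) //; planar.
Qed.

(** * String diagrams *)

Definition box : Type := nat * list wire.

Fixpoint out_names (p : list nat) (k : nat) (w : list nat) : list wire :=
  match w with
  | [] => []
  | a :: w => (a, k :: p) :: out_names p (S k) w
  end.

(* The outputs of a box are named after the box and the names of its inputs,
   so that equal diagrams produce equal names; a clash of names only makes
   [sym_check] fail. *)
Definition outs (b : box) : list wire :=
  let '(g, ins) := b in
  out_names (g :: flat_map (fun x => length (snd x) :: snd x) ins) 0 (tgt gens g).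

Lemma out_names_type p k w : map fst (out_names p k w) = w.
Proof. by elim: w k => [|a w IH] k //=; rewrite IH. Qed.

Definition ins (b : box) : list wire := snd b.

Definition garr (b : box) : arr V := gen_arr (gen_at gens (fst b)).

Definition good (b : box) : Prop := map fst (ins b) = src gens (fst b).

Lemma box_hom b : good b -> hom (wobs (ins b)) (wobs (outs b)) (garr b).
Proof.
case: b => g xs; rewrite /good /ins /wobs /= => ->; rewrite out_names_type.
exact: (gen_typed_at V_mon atoms_isob gens_typed).
Qed.

Definition after (b : box) (ws : list wire) := outs b ++ rm (ins b) ws.

(** Before each box a canonical symmetry brings its inputs to the front, and its outputs stay in
    front. All crossings are thus dictated by the names. *)
Fixpoint den (ws : list wire) (bs : list box) (ws' : list wire) : arr V :=
  match bs with
  | [] => can ws ws'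
  | b :: bs =>
      den (after b ws) bs ws' ∘ (garr b ⊠ wobs (rm (ins b) ws))
        ∘ can ws (ins b ++ rm (ins b) ws)
  end.

Fixpoint valid (ws : list wire) (bs : list box) (ws' : list wire) : Prop :=
  match bs with
  | [] => Permutation ws ws'
  | b :: bs =>
      good b /\ NoDup (ins b) /\ incl (ins b) ws /\ NoDup (outs b ++ ws) /\
      valid (after b ws) bs ws'
  end.

Lemma after_perm b ws ws1 : NoDup (ins b) -> incl (ins b) ws -> Permutation ws ws1 ->
  Permutation (rm (ins b) ws) (rm (ins b) ws1).
Proof.
move=> nd i h; apply: (Permutation_app_inv_l (ins b)).
apply: Permutation_trans (Permutation_sym (rm_perm nd i)) _.
apply: (Permutation_trans h); apply: rm_perm => // x /i.
exact: (Permutation_in x h).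
Qed.

Lemma after_nodup b ws : NoDup (ins b) -> incl (ins b) ws -> NoDup (outs b ++ ws) ->
  NoDup (after b ws).
Proof.
move=> nd i h; apply: (NoDup_app_remove_l (ins b)).
apply: Permutation_NoDup h; rewrite /after.
apply: Permutation_trans (Permutation_app_head _ (rm_perm nd i)) _.
rewrite !app_assoc; apply: Permutation_app_tail; exact: Permutation_app_comm.
Qed.

Lemma valid_perm ws ws1 bs ws' ws1' : Permutation ws ws1 -> Permutation ws' ws1' ->
  valid ws bs ws' -> valid ws1 bs ws1'.
Proof.
elim: bs ws ws1 => [|b bs IH] ws ws1 h h' /=.
  by move=> h''; exact: Permutation_trans (Permutation_sym h) (Permutation_trans h'' h').
case=> gb [nd [i [n v]]]; do ![split=> //].
- by move=> x /i; exact: (Permutation_in x h).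
- apply: Permutation_NoDup n; exact: Permutation_app_head.
- apply: IH v => //; apply: Permutation_app_head; exact: after_perm.
Qed.

Lemma den_hom ws bs ws' : valid ws bs ws' -> hom (wobs ws) (wobs ws') (den ws bs ws').
Proof.
elim: bs ws => [|b bs IH] ws /=; first exact: can_hom.
case=> gb [nd [i [n /IH v]]]; have hb := box_hom gb.
have hc := can_hom (rm_perm nd i).
have ? := wobs_isob (ins b); have ? := wobs_isob (outs b).
have ? := wobs_isob (rm (ins b) ws); have ? := wobs_isob ws; have ? := wobs_isob ws'.
by rewrite /after !wobs_app in hc v *; homs.
Qed.

Lemma den_can_r ws bs ws' ws'' : valid ws bs ws' -> Permutation ws' ws'' ->
  den ws bs ws'' = can ws' ws'' ∘ den ws bs ws'.
Proof.
move=> v p; have hp := can_hom p; elim: bs ws v => [|b bs IH] ws /=.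
  by move=> h; rewrite can_comp.
case=> gb [nd [i [n v]]]; rewrite (IH _ v); have hb := box_hom gb.
have hv := den_hom v; have hc := can_hom (rm_perm nd i).
have ? := wobs_isob (ins b); have ? := wobs_isob (outs b).
have ? := wobs_isob (rm (ins b) ws); have ? := wobs_isob ws.
have ? := wobs_isob ws'; have ? := wobs_isob ws''.
by rewrite /after !wobs_app in hc hv *; planar.
Qed.

(** The initial arrangement of wires is immaterial: by coherence the extra permutation merges with
    the one before the first box, and its effect on the idle wires passes on to the rest. *)
Lemma den_can_l ws ws1 bs ws' : valid ws bs ws' -> Permutation ws ws1 ->
  den ws bs ws' = den ws1 bs ws' ∘ can ws ws1.
Proof.
move=> v p; have v1 := valid_perm p (Permutation_refl ws') v.
elim: bs ws ws1 v v1 p => [|b bs IH] ws ws1 /=.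
  by move=> h h' p; rewrite can_comp.
case=> gb [nd [i [n v]]] [_ [_ [i1 [n1 v1]]]] p; have hb := box_hom gb.
have pr := after_perm nd i p; have pa := Permutation_app_head (outs b) pr.
have hr := can_hom pr; rewrite (IH _ _ v v1 pa) /after can_app_l //.
have pi := Permutation_app_head (ins b) pr.
have e : can ws1 (ins b ++ rm (ins b) ws1) ∘ can ws ws1 =
  (wobs (ins b) ⊠ can (rm (ins b) ws) (rm (ins b) ws1)) ∘ can ws (ins b ++ rm (ins b) ws).
  rewrite -can_app_l // !can_comp //; apply: rm_perm => //.
have hv := den_hom v1; have hc := can_hom (rm_perm nd i).
have hc1 := can_hom (rm_perm nd i1); have hp := can_hom p.
have ? := wobs_isob (ins b); have ? := wobs_isob (outs b).
have ? := wobs_isob (rm (ins b) ws); have ? := wobs_isob ws.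
have ? := wobs_isob (rm (ins b) ws1); have ? := wobs_isob ws1.
have ? := wobs_isob ws'.
rewrite /after !wobs_app in hc hc1 hv *.
transitivity ((den (outs b ++ rm (ins b) ws1) bs ws'
    ∘ (garr b ⊠ wobs (rm (ins b) ws1))) ∘
  ((wobs (ins b) ⊠ can (rm (ins b) ws) (rm (ins b) ws1)) ∘ can ws (ins b ++ rm (ins b) ws))).
  by planar.
rewrite -e; planar.
Qed.

Lemma valid_app ws bs1 ws1 bs2 ws2 : valid ws bs1 ws1 -> valid ws1 bs2 ws2 ->
  valid ws (bs1 ++ bs2) ws2.
Proof.
elim: bs1 ws => [|b bs1 IH] ws /=.
  by move=> p; apply: valid_perm => //; exact: Permutation_sym.
by case=> gb [nd [i [n v]]] v'; do ![split=> //]; exact: IH.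
Qed.

Lemma den_app ws bs1 ws1 bs2 ws2 : valid ws bs1 ws1 -> valid ws1 bs2 ws2 ->
  den ws (bs1 ++ bs2) ws2 = den ws1 bs2 ws2 ∘ den ws bs1 ws1.
Proof.
elim: bs1 ws => [|b bs1 IH] ws /=.
  move=> p v; apply: den_can_l => //.
  by apply: valid_perm v => //; exact: Permutation_sym.
case=> gb [nd [i [n v]]] v'; rewrite (IH _ v v'); have hb := box_hom gb.
have hv := den_hom v; have hv' := den_hom v'; have hc := can_hom (rm_perm nd i).
have ? := wobs_isob (ins b); have ? := wobs_isob (outs b).
have ? := wobs_isob (rm (ins b) ws); have ? := wobs_isob ws.
have ? := wobs_isob ws1; have ? := wobs_isob ws2.
by rewrite /after !wobs_app in hc hv hv' *; planar.
Qed.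

(** * Diagrams beside idle wires *)

Definition fresh (bs : list box) (v : list wire) : Prop :=
  forall b, In b bs -> forall x, In x (outs b) -> ~ In x v.

Lemma whisker_r ws bs ws' v : valid ws bs ws' -> NoDup (ws ++ v) -> fresh bs v ->
  valid (ws ++ v) bs (ws' ++ v) /\ den (ws ++ v) bs (ws' ++ v) = den ws bs ws' ⊠ wobs v.
Proof.
have hwv := wobs_isob v.
elim: bs ws => [|b bs IH] ws /=.
  by move=> p _ _; split; [exact: Permutation_app_tail|exact: can_app_r].
case=> gb [nd [i [n va]]] ndv fr; have hb := box_hom gb.
have n' : NoDup (outs b ++ ws ++ v).
  apply: NoDup_app => //; first exact: NoDup_app_remove_r n.
  move=> x xo /(@in_app_or _ _ _ _) [xw|xv].
    by case: (NoDup_app_disjoint n xo).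
  by apply: (fr b) xv => //; left.
have e : after b (ws ++ v) = after b ws ++ v.
  by rewrite /after rm_app // app_assoc.
have nda : NoDup (after b ws ++ v).
  by rewrite -e; apply: after_nodup => //; apply: incl_appl.
have fr' : fresh bs v by move=> b' hb'; apply: fr; right.
rewrite e rm_app //; case: (IH _ va nda fr') => va' ->.
split; first by do ![split=> //]; apply: incl_appl.
rewrite app_assoc can_app_r; first exact: rm_perm.
have hv := den_hom va; have hc := can_hom (rm_perm nd i).
have ? := wobs_isob (ins b); have ? := wobs_isob (outs b).
have ? := wobs_isob (rm (ins b) ws); have ? := wobs_isob ws; have ? := wobs_isob ws'.
by rewrite /after !wobs_app in hc hv *; planar.
Qed.

(** Boxes act at the front, so idle wires are easy to add only on the right. The left case is
    conjugated to the right one by block symmetries, which cancel by naturality and symmetry. *)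
Lemma whisker_l ws bs ws' u : valid ws bs ws' -> NoDup (u ++ ws) -> NoDup (u ++ ws') ->
  fresh bs u ->
  valid (u ++ ws) bs (u ++ ws') /\ den (u ++ ws) bs (u ++ ws') = wobs u ⊠ den ws bs ws'.
Proof.
move=> va n n' fr.
have p := Permutation_app_comm u ws; have p' := Permutation_app_comm ws' u.
have [va' e] := whisker_r va (Permutation_NoDup p n) fr.
have va1 := valid_perm (Permutation_refl _) p' va'.
have va2 := valid_perm (Permutation_sym p) (Permutation_refl _) va1.
split=> //; rewrite (den_can_l va2 p) (den_can_r va' p') e.
rewrite !can_swap //; first exact: (Permutation_NoDup (Permutation_sym p')).
have ? := wobs_isob u; have ? := wobs_isob ws; have ? := wobs_isob ws'.
have hid := wobs_hom u; have hd := den_hom va.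
rewrite (braid_nat V_br hd hid).
transitivity ((wobs u ⊠ den ws bs ws') ∘ (braid (wobs ws) (wobs u) ∘ braid (wobs u) (wobs ws))).
  planar.
rewrite (braid_sym V_sym) //; planar.
Qed.

Lemma can_swap_l u v w : NoDup (u ++ v ++ w) ->
  can (u ++ v ++ w) (v ++ u ++ w) = braid (wobs u) (wobs v) ⊠ wobs w.
Proof.
rewrite !app_assoc => h; rewrite can_app_r; first exact: Permutation_app_comm.
by rewrite can_swap //; exact: NoDup_app_remove_r h.
Qed.

(** Naturality slides each box through the block crossing next to it; the double crossings cancel,
    and interchange of the two boxes remains. *)
Lemma box_swap_front a b r bs ws' : NoDup (ins a ++ ins b ++ r) -> good a -> good b ->
  NoDup (outs a ++ ins a ++ ins b ++ r) -> NoDup (outs b ++ outs a ++ ins b ++ r) ->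
  (forall x, In x (outs b) -> ~ In x (ins a)) ->
  valid (outs b ++ outs a ++ r) bs ws' ->
  valid (ins a ++ ins b ++ r) (b :: a :: bs) ws' /\
  den (ins a ++ ins b ++ r) (a :: b :: bs) ws' = den (ins a ++ ins b ++ r) (b :: a :: bs) ws'.
Proof.
move=> n ga gb na nb d v; have ha := box_hom ga; have hb := box_hom gb.
have n2 := NoDup_app_remove_l _ _ n; have na2 := NoDup_app_remove_l _ _ nb.
have e1 : rm (ins b) (outs a ++ ins b ++ r) = outs a ++ r.
  rewrite rm_app_disjoint ?rm_self // => x xb xa.
  by case: (NoDup_app_disjoint na2 xa); apply: in_or_app; left.
have e2 : rm (ins b) (ins a ++ ins b ++ r) = ins a ++ r.
  rewrite rm_app_disjoint ?rm_self // => x xb xa.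
  by case: (NoDup_app_disjoint n xa); apply: in_or_app; left.
have e3 : rm (ins a) (outs b ++ ins a ++ r) = outs b ++ r.
  by rewrite rm_app_disjoint ?rm_self // => x xa xb; case: (d x xb).
have p12 : Permutation (ins a ++ ins b ++ r) (ins b ++ ins a ++ r).
  by rewrite !app_assoc; apply: Permutation_app_tail; exact: Permutation_app_comm.
have po : Permutation (outs b ++ outs a ++ r) (outs a ++ outs b ++ r).
  by rewrite !app_assoc; apply: Permutation_app_tail; exact: Permutation_app_comm.
have n3 : NoDup (outs b ++ ins a ++ ins b ++ r).
  apply: NoDup_app => //; first exact: NoDup_app_remove_r nb.
  move=> x xb /(@in_app_or _ _ _ _) [xa|h]; first by case: (d x xb).
  by case: (NoDup_app_disjoint nb xb); apply: in_or_app; right.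
have n4 : NoDup (outs b ++ ins a ++ r).
  apply: (NoDup_app_remove_l (ins b)); apply: Permutation_NoDup n3.
  apply: Permutation_trans (Permutation_app_head _ p12) _.
  by rewrite !app_assoc; do 2 apply: Permutation_app_tail; exact: Permutation_app_comm.
have n5 : NoDup (outs b ++ outs a ++ r).
  apply: (NoDup_app_remove_l (ins b)); apply: Permutation_NoDup nb.
  apply: Permutation_trans (_ : Permutation _ (outs b ++ ins b ++ outs a ++ r)) _.
    apply: Permutation_app_head.
    by rewrite !app_assoc; apply: Permutation_app_tail; exact: Permutation_app_comm.
  by rewrite !app_assoc; do 2 apply: Permutation_app_tail; exact: Permutation_app_comm.
have v' := valid_perm po (Permutation_refl ws') v.
have hd := den_hom v.
split.
{ rewrite /= /after e2 e3; do ![split=> //].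
  - exact: NoDup_app_remove_r n2.
  - by move=> x h; apply: in_or_app; right; apply: in_or_app; left.
  - exact: NoDup_app_remove_r n.
  - by move=> x h; apply: in_or_app; right; apply: in_or_app; left.
  - apply: NoDup_app => //.
    + exact: NoDup_app_remove_r na.
    + move=> x xa /(@in_app_or _ _ _ _) [xb|/(@in_app_or _ _ _ _) [xi|xr]].
      * by case: (NoDup_app_disjoint nb xb); apply: in_or_app; left.
      * by case: (NoDup_app_disjoint na xa); apply: in_or_app; left.
      * case: (NoDup_app_disjoint na xa); apply: in_or_app; right.
        by apply: in_or_app; right.
}
cbn [den]; rewrite /after rm_self e1 e2 e3 can_refl.
rewrite !can_swap_l //.
rewrite (den_can_l v po) can_swap_l //.
have {}hd := den_hom v'.
have ? := wobs_isob (ins a); have ? := wobs_isob (outs a).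
have ? := wobs_isob (ins b); have ? := wobs_isob (outs b).
have ? := wobs_isob r; have ? := wobs_isob ws'.
have hida := wobs_hom (ins a); have hidb := wobs_hom (ins b).
have hidoa := wobs_hom (outs a); have hidob := wobs_hom (outs b).
rewrite !wobs_app in hd *.
set D := den _ _ _ in hd *.
transitivity (D ∘ (((braid (wobs (outs b)) (wobs (outs a)) ∘ (garr b ⊠ wobs (outs a)))
   ∘ braid (wobs (outs a)) (wobs (ins b)) ∘ (garr a ⊠ wobs (ins b))) ⊠ wobs r)).
  planar.
transitivity (D ∘ (((garr a ⊠ wobs (outs b)) ∘
   (braid (wobs (outs b)) (wobs (ins a)) ∘ (garr b ⊠ wobs (ins a)))
   ∘ braid (wobs (ins a)) (wobs (ins b))) ⊠ wobs r)); last planar.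
rewrite (braid_nat V_br hb hidoa) (braid_nat V_br hb hida).
transitivity (D ∘ (((wobs (outs a) ⊠ garr b) ∘
  (braid (wobs (ins b)) (wobs (outs a)) ∘ braid (wobs (outs a)) (wobs (ins b))) ∘
  (garr a ⊠ wobs (ins b))) ⊠ wobs r)); first planar.
transitivity (D ∘ (((garr a ⊠ wobs (outs b)) ∘ (wobs (ins a) ⊠ garr b) ∘
  (braid (wobs (ins b)) (wobs (ins a)) ∘ braid (wobs (ins a)) (wobs (ins b))))
  ⊠ wobs r)); last planar.
rewrite !(braid_sym V_sym) //; planar.
Qed.

(** Rearranging the wires so that the inputs of [a] and [b] come first, which [den_can_l] allows,
    reduces this to [box_swap_front]. *)
Lemma box_swap ws a b bs ws' : NoDup ws -> valid ws (a :: b :: bs) ws' ->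
  (forall x, In x (ins b) -> ~ In x (outs a)) ->
  (forall x, In x (outs b) -> ~ In x (ins a)) ->
  valid ws (b :: a :: bs) ws' /\ den ws (a :: b :: bs) ws' = den ws (b :: a :: bs) ws'.
Proof.
move=> n v d d'; have := v; cbn [valid]; rewrite {1 2 3}/after.
case=> ga [nia [ia [na [gb [nib [ib [nb v']]]]]]].
have ib' : incl (ins b) (rm (ins a) ws).
  by move=> x xb; case/(@in_app_or _ _ _ _): (ib _ xb) => // xa; case: (d x xb).
set r := rm (ins b) (rm (ins a) ws).
have pa : Permutation (rm (ins a) ws) (ins b ++ r) by exact: rm_perm.
have p : Permutation ws (ins a ++ ins b ++ r).
  exact: Permutation_trans (rm_perm nia ia) (Permutation_app_head _ pa).
have e : rm (ins b) (outs a ++ rm (ins a) ws) = outs a ++ r.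
  by rewrite rm_app_disjoint.
case: (@box_swap_front a b r bs ws') => //.
- exact: Permutation_NoDup p n.
- apply: Permutation_NoDup na; exact: Permutation_app_head.
- by apply: Permutation_NoDup nb; do 2 apply: Permutation_app_head.
- by move: v'; rewrite /after e.
- move=> v2 e2; have v3 := valid_perm (Permutation_sym p) (Permutation_refl _) v2.
  by split=> //; rewrite (den_can_l v p) (den_can_l v3 p) e2.
Qed.

(** * Deciding equality of diagrams in a symmetric category *)

Definition box_eq_dec (a b : box) : {a = b} + {a <> b}.
Proof. by repeat decide equality. Defined.

Definition memb (x : wire) (l : list wire) : bool :=
  if in_dec wire_eq_dec x l is left _ then true else false.

Definition disjointb (u v : list wire) : bool :=
  forallb (fun x => negb (memb x v)) u.

Lemma disjointbP u v : disjointb u v = true -> forall x, In x u -> ~ In x v.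
Proof.
rewrite /disjointb => h x xu; move: (proj1 (forallb_forall _ _) h x xu).
by rewrite /memb; case: in_dec.
Qed.

Fixpoint nodupb (l : list wire) : bool :=
  match l with
  | [] => true
  | x :: l => negb (memb x l) && nodupb l
  end.

Lemma nodupbP l : nodupb l = true -> NoDup l.
Proof.
elim: l => [|x l IH] /=; first by move=> _; exact: NoDup_nil.
move/(proj1 (andb_true_iff _ _)) => [h /IH h']; apply: NoDup_cons => //.
by move: h; rewrite /memb; case: in_dec.
Qed.

(** Brings [b] to the front past boxes independent of it. Since the names of its inputs record how
    they were produced, [b] can be recognized in another diagram by plain equality. *)
Fixpoint extract (b : box) (bs : list box) : option (list box) :=
  match bs with
  | [] => None
  | a :: bs =>
      if box_eq_dec a b is left _ then Some bs
      else if disjointb (ins b) (outs a) && disjointb (outs b) (ins a) then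
        if extract b bs is Some r then Some (a :: r) else None
      else None
  end.

Lemma extract_sound ws b bs r ws' : NoDup ws -> valid ws bs ws' ->
  extract b bs = Some r ->
  valid ws (b :: r) ws' /\ den ws bs ws' = den ws (b :: r) ws'.
Proof.
elim: bs ws r => [|a bs IH] ws r n v //=.
case: box_eq_dec => [<- [<-] //|_].
case e: (_ && _) => //; case/(proj1 (andb_true_iff _ _)): e => d d'.
case e: (extract b bs) => [r'|] // [<-].
case: (v) => ga [nd [i [na v']]].
case: (IH _ _ (after_nodup nd i na) v' e) => v2 e2.
have v3 : valid ws (a :: b :: r') ws' by do ![split=> //].
case: (box_swap n v3 (disjointbP d) (disjointbP d')) => v4 e4.
by split=> //; rewrite -[RHS]e4 /= e2.
Qed.

Fixpoint same_boxes (bs bs' : list box) : bool :=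
  match bs' with
  | [] => if bs is [] then true else false
  | b :: bs' => if extract b bs is Some r then same_boxes r bs' else false
  end.

Lemma same_boxes_sound ws bs bs' ws' : NoDup ws -> valid ws bs ws' ->
  same_boxes bs bs' = true -> den ws bs ws' = den ws bs' ws'.
Proof.
elim: bs' ws bs => [|b bs' IH] ws bs n v /=; first by case: bs v.
case e: (extract b bs) => [r|] // h; case: (extract_sound n v e) => v' ->.
case: (v') => gb [nd [i [nb v2]]] /=.
by rewrite (IH _ _ (after_nodup nd i nb) v2 h).
Qed.

(** Symbolic execution on named wires: identities and braidings produce no box, a braiding only
    reorders the names. Clashes of names are detected here and make the run fail. *)
Fixpoint trace (t : term) (ws : list wire) : option (list box * list wire) :=
  match t with
  | TId o =>
      if list_nat_eq_dec (map fst ws) (flat o) is left _ then Some ([], ws) else None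
  | TGen g =>
      if list_nat_eq_dec (map fst ws) (src gens g) is left _ then
        if nodupb (outs (g, ws) ++ ws) then Some ([(g, ws)], outs (g, ws)) else None
      else None
  | TBraid o o' =>
      let u := firstn (length (flat o)) ws in
      let v := skipn (length (flat o)) ws in
      if list_nat_eq_dec (map fst u) (flat o) is left _ then
        if list_nat_eq_dec (map fst v) (flat o') is left _ then Some ([], v ++ u)
        else None
      else None
  | TComp g f =>
      if trace f ws is Some (bs1, ws1) then
        if trace g ws1 is Some (bs2, ws2) then Some (bs1 ++ bs2, ws2) else None
      else None
  | TTens f g =>
      if ttype gens f is Some (a, _) then
        let u := firstn (length a) ws in
        let v := skipn (length a) ws in
        if trace f u is Some (bs1, u') then
          if trace g v is Some (bs2, v') then
            if forallb (fun b => disjointb (outs b) v) bs1 &&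
               forallb (fun b => disjointb (outs b) u') bs2 && nodupb (u' ++ v')
            then Some (bs1 ++ bs2, u' ++ v') else None
          else None
        else None
      else None
  end.

Lemma fresh_forallb bs v :
  forallb (fun b => disjointb (outs b) v) bs = true -> fresh bs v.
Proof. by move=> h b hb; exact/disjointbP/(proj1 (forallb_forall _ _) h). Qed.

Lemma oden_wobs o ws : map fst ws = flat o -> oden atoms o = wobs ws.
Proof. by move=> h; rewrite (oden_flat V_mon atoms_isob) -h. Qed.

Lemma valid_nodup ws bs ws' : NoDup ws -> valid ws bs ws' -> NoDup ws'.
Proof.
elim: bs ws => [|b bs IH] ws n /=; first by move=> p; exact: Permutation_NoDup p n.
by case=> gb [nd [i [nb v]]]; exact: IH (after_nodup nd i nb) v.
Qed.

Lemma trace_sound t ws bs ws' : NoDup ws -> trace t ws = Some (bs, ws') ->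
  valid ws bs ws' /\ tden atoms gens (@braid V) t = den ws bs ws'.
Proof.
elim: t ws bs ws' => [o|g|o o'|g IHg f IHf|f IHf g IHg] ws bs ws' n /=.
- case: list_nat_eq_dec => // e [<- <-]; split; first exact: Permutation_refl.
  by rewrite /= can_refl (oden_wobs e).
- case: list_nat_eq_dec => // e; case nd: nodupb => // -[<- <-].
  have gb : good (g, ws) by [].
  have hb : hom (wobs ws) (wobs (outs (g, ws))) (garr (g, ws)) := box_hom gb.
  have := nodupbP nd => {}nd.
  have r : rm ws ws = [] by have := rm_self ws []; rewrite app_nil_r.
  split; first by rewrite /= /after /= r app_nil_r; do ![split=> //].
  rewrite [RHS]/= /after [ins _]/= r !app_nil_r !can_refl.
  have ? := wobs_isob ws; have ? := wobs_isob (outs (g, ws)).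
  change (garr (g, ws) = wobs (outs (g, ws)) ∘ (garr (g, ws) ⊠ unit_ob) ∘ wobs ws).
  planar.
- case: list_nat_eq_dec => // e; case: list_nat_eq_dec => // e' [<- <-] /=.
  rewrite (oden_wobs e) (oden_wobs e'); have := firstn_skipn (length (flat o)) ws.
  set u := firstn _ ws; set v := skipn _ ws => h; rewrite -{}h in n *.
  by split; [exact: Permutation_app_comm|rewrite can_swap].
- case e1: (trace f ws) => [[bs1 ws1]|] //; case e2: (trace g ws1) => [[bs2 ws2]|] // [<- <-].
  case: (IHf _ _ _ n e1) => v1 ->.
  case: (IHg _ _ _ (valid_nodup n v1) e2) => v2 ->.
  by rewrite (den_app v1 v2); split=> //; exact: valid_app v2.
- case: (ttype gens f) => [[a b]|] //; have := firstn_skipn (length a) ws.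
  set u := firstn _ ws; set v := skipn _ ws => h; rewrite -{}h in n *.
  case e1: (trace f u) => [[bs1 u']|] //; case e2: (trace g v) => [[bs2 v']|] //.
  case e: (_ && _) => // -[<- <-].
  case/(proj1 (andb_true_iff _ _)): e => /(proj1 (andb_true_iff _ _)) [f1 f2] /nodupbP n'.
  have nu : NoDup u := NoDup_app_remove_r _ _ n.
  have nv : NoDup v := NoDup_app_remove_l _ _ n.
  case: (IHf _ _ _ nu e1) (IHg _ _ _ nv e2) => v1 -> [v2 ->].
  case: (whisker_r v1 n (fresh_forallb f1)) => w1 h1.
  case: (whisker_l v2 (valid_nodup n w1) n' (fresh_forallb f2)) => w2 h2.
  split; first exact: valid_app w2.
  rewrite (den_app w1 w2) h1 h2.
  have d1 := den_hom v1; have d2 := den_hom v2.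
  have ? := wobs_isob u; have ? := wobs_isob v.
  have ? := wobs_isob u'; have ? := wobs_isob v'; planar.
Qed.

Fixpoint inputs (i : nat) (w : list nat) : list wire :=
  match w with
  | [] => []
  | a :: w => (a, [i]) :: inputs (S i) w
  end.

Definition wires_eq_dec := list_eq_dec wire_eq_dec.

(** Both terms run on the same named inputs. Equal output lists mean that the wires end in the same
    arrangement, and the boxes need agree only up to reordering. *)
Definition sym_check (t t' : term) : bool :=
  if ttype gens t is Some (a, _) then
    let ws := inputs 0 a in
    if trace t ws is Some (bs, u) then
      if trace t' ws is Some (bs', u') then
        if wires_eq_dec u u' is left _ then nodupb ws && same_boxes bs bs' else false
      else false
    else false
  else false.

Lemma sym_check_sound t t' : sym_check t t' = true ->
  tden atoms gens (@braid V) t = tden atoms gens (@braid V) t'.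
Proof.
rewrite /sym_check; case: ttype => [[a b]|] //.
case e: (trace t _) => [[bs u]|] //; case e': (trace t' _) => [[bs' u']|] //.
case: wires_eq_dec => // h; subst u'.
case/(proj1 (andb_true_iff _ _)) => /nodupbP n s.
case: (trace_sound n e) (trace_sound n e') => v -> [v' ->].
exact: same_boxes_sound.
Qed.

(** * Rewriting in a string diagram *)

Fixpoint lookup (x : wire) (s : list (wire * wire)) : option wire :=
  match s with
  | [] => None
  | (y, z) :: s => if wire_eq_dec x y is left _ then Some z else lookup x s
  end.

(** The substitution [s] sends wires of the pattern to wires of the diagram. *)
Fixpoint unify (s : list (wire * wire)) (xs ys : list wire) : option (list (wire * wire)) :=
  match xs, ys with
  | [], [] => Some s
  | x :: xs, y :: ys =>
      match lookup x s with
      | Some z => if wire_eq_dec z y is left _ then unify s xs ys else None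
      | None => unify ((x, y) :: s) xs ys
      end
  | _, _ => None
  end.

(** Backtracking search for all occurrences. Outputs are unified as well as inputs, so that later
    boxes of the pattern are matched along the same internal wires. *)
Fixpoint matches (pat bs : list box) (s : list (wire * wire)) (used : list box) :
    list (list (wire * wire) * list box) :=
  match pat with
  | [] => [(s, used)]
  | p :: pat =>
      flat_map (fun b =>
        if Nat.eqb (fst p) (fst b) then
          if unify s (ins p) (ins b) is Some s then
            if unify s (outs p) (outs b) is Some s then matches pat bs s (b :: used)
            else []
          else []
        else []) bs
  end.

Fixpoint subset (u v : list wire) : bool :=
  match u with
  | [] => true
  | x :: u => memb x v && subset u v
  end.

(** The first list holds the boxes that can run before the matched ones, the second those that
    depend on their outputs. *)
Fixpoint separate (avail : list wire) (used bs : list box) : list box * list box :=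
  match bs with
  | [] => ([], [])
  | b :: bs =>
      if in_dec box_eq_dec b used is left _ then separate avail used bs
      else if subset (ins b) avail then
        let '(l, r) := separate (outs b ++ avail) used bs in (b :: l, r)
      else let '(l, r) := separate avail used bs in (l, b :: r)
  end.

Fixpoint olist (w : list nat) : oexp :=
  match w with
  | [] => OUnit
  | [a] => OAtom a
  | a :: w => OTens (OAtom a) (olist w)
  end.

Definition owires (ws : list wire) : oexp := olist (map fst ws).

Definition tid (ws : list wire) : term := TId (owires ws).

Definition ttens_r (f : term) (ws : list wire) : term :=
  if ws is [] then f else TTens f (tid ws).

Fixpoint before (x : wire) (ws : list wire) : list wire :=
  match ws with
  | [] => []
  | y :: ws => if wire_eq_dec x y is left _ then [] else y :: before x ws
  end.

(** A syntactic counterpart of [can] using block braidings; the last wire of [xs] is moved first. *)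
Fixpoint tfront (xs ws : list wire) (t : term) : term :=
  match xs with
  | [] => t
  | x :: xs =>
      let t := tfront xs ws t in
      let ws := xs ++ rm xs ws in
      let u := before x ws in
      let v := skipn (S (length u)) ws in
      if u is [] then t else TComp (ttens_r (TBraid (owires u) (OAtom (fst x))) v) t
  end.

Fixpoint tboxes (bs : list box) (ws : list wire) (t : term) : list wire * term :=
  match bs with
  | [] => (ws, t)
  | b :: bs =>
      let rest := rm (ins b) ws in
      tboxes bs (outs b ++ rest) (TComp (ttens_r (TGen (fst b)) rest) (tfront (ins b) ws t))
  end.

(* Writes [t] as C2 ∘ (l ⊗ rest) ∘ C1, using the [n]-th occurrence of [l] in
   [t]; nothing is proved about it, [plug_sound] has the decomposition checked
   by [sym_check]. *)
Definition split_at (t l : term) (n : nat) : option (term * list wire * term) :=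
  if ttype gens t is Some (a, _) then
  if ttype gens l is Some (c, _) then
    let ws := inputs 0 a in
    let wl := inputs 0 c in
    if trace t ws is Some (bs, ws') then
    if trace l wl is Some (bl, wl') then
      if nth_error (matches bl bs [] []) n is Some (s, used) then
        let img := fun x => if lookup x s is Some y then y else x in
        let '(bs1, bs2) := separate ws used bs in
        let '(ws1, t1) := tboxes bs1 ws (tid ws) in
        let xs := map img wl in
        let ys := map img wl' in
        let rest := rm xs ws1 in
        let '(ws2, t2) := tboxes bs2 (ys ++ rest) (tid (ys ++ rest)) in
        Some (tfront ws' ws2 t2, rest, tfront xs ws1 t1)
      else None
    else None
    else None
  else None
  else None.

Definition plug (c : term * list wire * term) (m : term) : term :=
  let '(c2, rest, c1) := c in TComp c2 (TComp (ttens_r m rest) c1).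

Lemma plug_sound t l r c : sym_check t (plug c l) = true ->
  tden atoms gens (@braid V) l = tden atoms gens (@braid V) r ->
  tden atoms gens (@braid V) t = tden atoms gens (@braid V) (plug c r).
Proof.
move/sym_check_sound ->; case: c => [[c2 rest] c1] /= e.
by case: rest => [|x rest] /=; rewrite e.
Qed.

End Wires.

(** * Tactics for diagrams in a symmetric category *)

Ltac sym_gens_ok := forall_list; rewrite /gen_typed /=; assumption.

Ltac sym_env s t k :=
  lazymatch goal with
  | hS : strict_symmetric ?V |- _ =>
      let hB := constr:(sym_strict_braided hS) in
      let hM := constr:(br_strict_monoidal hB) in
      let l := arr_atoms true s (@nil (ob V)) in
      let l := arr_atoms true t l in
      let gs := arr_gens true s l (@nil (gen V)) in
      let gs := arr_gens true t l gs in
      k V hS hM l gs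
  end.

Ltac diagram :=
  lazymatch goal with
  | |- ?s = ?t =>
      sym_env s t ltac:(fun V hS hM l gs =>
        let s' := reify_arr true s l gs in
        let t' := reify_arr true t l gs in
        refine (@sym_check_sound V hS l gs _ _ s' t' _);
        [atoms_ok hM | sym_gens_ok | vm_compute; reflexivity])
  end.

Ltac drewrite_at e n :=
  let te := type of e in
  lazymatch te with
  | ?u = ?v =>
      lazymatch goal with
      | |- ?s = _ =>
          (* This composite only serves to collect the atoms and generators of both sides of [e]; it
             need not be well typed. *)
          let uv := constr:(u ∘ v) in
          sym_env s uv ltac:(fun V hS hM l gs =>
            let s' := reify_arr true s l gs in
            let u' := reify_arr true u l gs in
            let v' := reify_arr true v l gs in
            let c := eval vm_compute in (split_at gs s' u' n) in
            lazymatch c with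
            | Some ?c =>
                let p := eval vm_compute in (plug c v') in
                let d := eval cbv [tden oden atom gen_at gen_arr nth] in
                  (tden l gs (@braid V) p) in
                refine (@eq_trans _ _ d _ (@plug_sound V hS l gs _ _ s' u' v' c _ e) _);
                [atoms_ok hM | sym_gens_ok | vm_compute; reflexivity | idtac]
            | None => fail "no such occurrence"
            end)
      end
  end.

Tactic Notation "drewrite" constr(e) := drewrite_at e O.
Tactic Notation "drewrite" constr(e) "at" constr(n) := drewrite_at e n.

(** * Yetter-Drinfeld modules *)

Section YetterDrinfeld.

Variables (V : braided_data) (V_sym : strict_symmetric V).
Variables (Ha : hopf_data V) (Ha_hopf : hopf_algebra Ha).

Local Notation H := (hcar Ha).
Local Notation μ := (hmul Ha).
Local Notation η := (hunit Ha).
Local Notation Δ := (hcomul Ha).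
Local Notation ϵ := (hcounit Ha).
Local Notation S := (hanti Ha).
Local Notation P := (@braid V).

Let V_br := sym_strict_braided V_sym.
Let V_mon := br_strict_monoidal V_br.
Let V_cat := mon_category V_mon.
(* Found in the context by the reification tactics. *)
Let H_isob : isob H := hcar_isob Ha_hopf.
Let μ_hom : hom (H ⊗ H) H μ := hmul_hom Ha_hopf.
Let η_hom : hom unit_ob H η := hunit_hom Ha_hopf.
Let Δ_hom : hom H (H ⊗ H) Δ := hcomul_hom Ha_hopf.
Let ϵ_hom : hom H unit_ob ϵ := hcounit_hom Ha_hopf.
Let S_hom : hom H H S := hanti_hom Ha_hopf.

Definition yd_compat_alt (X : ob V) (α β : arr V) : Prop :=
  (μ ⊠ X) ∘ (H ⊠ P X H) ∘ ((β ∘ α) ⊠ H) ∘ (H ⊠ P H X) ∘ (Δ ⊠ X) =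
  (μ ⊠ α) ∘ (H ⊠ P H H ⊠ X) ∘ (Δ ⊠ β).

(** Substituting the compatibility leaves Σ h₁ x₋₁ S(h₃) h₄ ⊗ h₂ x₀, where S(h₃) h₄ collapses. *)
Lemma yd_compat_to_alt (X : ob V) (α β : arr V) : isob X ->
  hom (H ⊗ X) X α -> hom X (H ⊗ X) β ->
  β ∘ α = (hmul3 Ha ⊠ α) ∘ yd_swap24 Ha X ∘ (H ⊠ H ⊠ S ⊠ H ⊠ X) ∘ (hcomul3 Ha ⊠ β) ->
  yd_compat_alt X α β.
Proof.
move=> hX hα hβ; rewrite /hmul3 /hcomul3 /yd_swap24 => e; rewrite /yd_compat_alt.
drewrite e.
drewrite (hmul_assoc Ha_hopf) at 1.
drewrite (hcomul_coassoc Ha_hopf) at 0.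
drewrite (hanti_left Ha_hopf).
drewrite (hcomul_counitr Ha_hopf).
drewrite (hmul_unitr Ha_hopf).
diagram.
Qed.

Lemma yd_compat_of_alt (X : ob V) (α β : arr V) : isob X ->
  hom (H ⊗ X) X α -> hom X (H ⊗ X) β -> yd_compat_alt X α β ->
  β ∘ α = (hmul3 Ha ⊠ α) ∘ yd_swap24 Ha X ∘ (H ⊠ H ⊠ S ⊠ H ⊠ X) ∘ (hcomul3 Ha ⊠ β).
Proof.
rewrite /yd_compat_alt /hmul3 /hcomul3 /yd_swap24 => hX hα hβ e.
(* In elements Σ (h₁x)₋₁ h₂ S(h₃) ⊗ (h₁x)₀: a collapsing product is inserted so that the hypothesis
   applies to h₁ and h₂. *)
transitivity ((μ ⊠ X) ∘ (H ⊠ P X H) ∘ ((β ∘ α) ⊠ (μ ∘ (H ⊠ S) ∘ Δ)) ∘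
  (H ⊠ P H X) ∘ (Δ ⊠ X)).
  symmetry.
  drewrite (hanti_right Ha_hopf).
  drewrite (hcomul_counitr Ha_hopf).
  drewrite (hmul_unitr Ha_hopf).
  diagram.
drewrite (eq_sym (hcomul_coassoc Ha_hopf)).
drewrite (eq_sym (hmul_assoc Ha_hopf)).
drewrite e.
diagram.
Qed.

Lemma yd_module_alt (X : yd_data V) : is_yd_module Ha X ->
  yd_compat_alt (yd_car X) (yd_act X) (yd_coact X).
Proof. by case=> hX hα hβ _ _ _ _; exact: yd_compat_to_alt. Qed.

(** * The monoidal category of Yetter-Drinfeld modules *)

Lemma yd_unit_module : is_yd_module Ha (yd_unit Ha).
Proof.
have hI := unit_isob V_mon; split=> //=.
- by rewrite (tens_ob_unitr V_mon).
- by rewrite (tens_ob_unitr V_mon).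
- drewrite (hcounit_mul Ha_hopf); diagram.
- drewrite (hcounit_unit Ha_hopf); diagram.
(* Two copies of [η] occur, and their outputs would share a name; planar diagrams carry no names. *)
- transitivity (Δ ∘ η); first planar.
  rewrite (hcomul_unit Ha_hopf); planar.
- drewrite (hcounit_unit Ha_hopf); diagram.
- rewrite /hmul3 /hcomul3 /yd_swap24; symmetry.
  drewrite (hmul_unitr Ha_hopf).
  drewrite (hcomul_counitr Ha_hopf).
  drewrite (hanti_right Ha_hopf).
  diagram.
Qed.

Lemma yd_tens_module (X X' : yd_data V) :
  is_yd_module Ha X -> is_yd_module Ha X' -> is_yd_module Ha (yd_tens Ha X X').
Proof.
move=> mX mX'; have := yd_module_alt mX; have := yd_module_alt mX'.
case: X X' mX mX' => [X α β] [X' α' β'].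
case=> /= hX hα hβ am au cc cu _ [/= hX' hα' hβ' am' au' cc' cu' _].
rewrite /yd_compat_alt => c' c.
have hXX' := tens_isob V_mon hX hX'.
have hαα : hom (H ⊗ (X ⊗ X')) (X ⊗ X')
  ((α ⊠ α') ∘ (H ⊠ P H X ⊠ X') ∘ (Δ ⊠ X ⊠ X')) by homs.
have hββ : hom (X ⊗ X') (H ⊗ (X ⊗ X'))
  ((μ ⊠ X ⊠ X') ∘ (H ⊠ P X H ⊠ X') ∘ (β ⊠ β')) by homs.
split=> //=.
- drewrite (hcomul_mul Ha_hopf).
  drewrite am.
  drewrite am'.
  diagram.
- (* [diagram] would give the same name to the outputs of two copies of η. *)
  have e (u v : arr V) : hom unit_ob H u -> hom unit_ob H v ->
    (α ⊠ α') ∘ (H ⊠ P H X ⊠ X') ∘ (u ⊠ v ⊠ X ⊠ X') = (α ∘ (u ⊠ X)) ⊠ (α' ∘ (v ⊠ X')).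
    by move=> hu hv; diagram.
  transitivity ((α ⊠ α') ∘ (H ⊠ P H X ⊠ X') ∘ ((Δ ∘ η) ⊠ X ⊠ X')); first diagram.
  by rewrite (hcomul_unit Ha_hopf) e // au au'; diagram.
- drewrite (hcomul_mul Ha_hopf).
  drewrite cc.
  drewrite cc'.
  diagram.
- drewrite (hcounit_mul Ha_hopf).
  drewrite cu.
  drewrite cu'.
  diagram.
(* The first tensor factor runs (h₁x)₋₁ (h₂x')₋₁ h₃ = (h₁x)₋₁ h₂ x'₋₁ = h₁ x₋₁ x'₋₁, by [c'] and
   then [c]; (co)associativity brings the adjacent pairs together. *)
- apply: yd_compat_of_alt => //; rewrite /yd_compat_alt.
  drewrite (hmul_assoc Ha_hopf).
  drewrite (hcomul_coassoc Ha_hopf).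
  drewrite c'.
  drewrite (eq_sym (hmul_assoc Ha_hopf)).
  drewrite (eq_sym (hcomul_coassoc Ha_hopf)).
  drewrite c.
  drewrite (hmul_assoc Ha_hopf).
  drewrite (hcomul_coassoc Ha_hopf).
  diagram.
Qed.

Lemma yd_mor_idm (X : yd_data V) : is_yd_module Ha X -> is_yd_morphism Ha X X (yd_car X).
Proof.
move=> m; split=> //; case: m => hX hα hβ *; first exact: (idm_hom V_cat hX).
  diagram.
diagram.
Qed.

Lemma yd_mor_comp (X Y Z : yd_data V) (f g : arr V) :
  is_yd_morphism Ha X Y f -> is_yd_morphism Ha Y Z g -> is_yd_morphism Ha X Z (g ∘ f).
Proof.
case=> mX mY hf fa fc [_ mZ hg ga gc]; split=> //; first exact: (comp_hom V_cat hf hg).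
  case: mX mY mZ => ? ? ? _ _ _ _ _ [? ? ? _ _ _ _ _] [? ? ? _ _ _ _ _].
  drewrite fa.
  drewrite ga.
  diagram.
case: mX mY mZ => ? ? ? _ _ _ _ _ [? ? ? _ _ _ _ _] [? ? ? _ _ _ _ _].
drewrite gc.
drewrite fc.
diagram.
Qed.

Lemma yd_mor_inv (X Y : yd_data V) (f g : arr V) : is_yd_morphism Ha X Y f ->
  hom (yd_car Y) (yd_car X) g -> g ∘ f = yd_car X -> f ∘ g = yd_car Y ->
  is_yd_morphism Ha Y X g.
Proof.
case=> mX mY hf fa fc hg gf fg; split=> //.
  case: mX mY => ? ? ? _ _ _ _ _ [? ? ? _ _ _ _ _].
  transitivity (g ∘ yd_act Y ∘ (H ⊠ (f ∘ g))); first by rewrite fg; diagram.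
  drewrite (eq_sym fa).
  drewrite gf.
  diagram.
case: mX mY => ? ? ? _ _ _ _ _ [? ? ? _ _ _ _ _].
transitivity ((H ⊠ (g ∘ f)) ∘ yd_coact X ∘ g); first by rewrite gf; diagram.
drewrite (eq_sym fc).
drewrite fg.
diagram.
Qed.

Lemma yd_mor_tens (X X' Y Y' : yd_data V) (f g : arr V) :
  is_yd_morphism Ha X X' f -> is_yd_morphism Ha Y Y' g ->
  is_yd_morphism Ha (yd_tens Ha X Y) (yd_tens Ha X' Y') (f ⊠ g).
Proof.
case=> mX mX' hf fa fc [mY mY' hg ga gc].
split; [exact: yd_tens_module|exact: yd_tens_module|exact: (tens_hom V_mon hf hg)| |];
  case: mX mX' mY mY' => ? ? ? _ _ _ _ _ [? ? ? _ _ _ _ _]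
    [? ? ? _ _ _ _ _] [? ? ? _ _ _ _ _] /=.
  drewrite fa.
  drewrite ga.
  diagram.
drewrite fc.
drewrite gc.
diagram.
Qed.

Lemma yd_tens_assoc (X Y Z : yd_data V) :
  is_yd_module Ha X -> is_yd_module Ha Y -> is_yd_module Ha Z ->
  yd_tens Ha X (yd_tens Ha Y Z) = yd_tens Ha (yd_tens Ha X Y) Z.
Proof.
move=> [? ? ? _ _ _ _ _] [? ? ? _ _ _ _ _] [? ? ? _ _ _ _ _].
rewrite /yd_tens /=; congr YDData.
- by rewrite (tens_ob_assoc V_mon).
- drewrite (eq_sym (hcomul_coassoc Ha_hopf)).
  diagram.
- drewrite (eq_sym (hmul_assoc Ha_hopf)).
  diagram.
Qed.

Lemma yd_tens_unit_l (X : yd_data V) : is_yd_module Ha X -> yd_tens Ha (yd_unit Ha) X = X.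
Proof.
case: X => X α β [/= ? ? ? _ _ _ _ _]; rewrite /yd_tens /=; congr YDData.
- exact: (tens_ob_unitl V_mon).
- drewrite (hcomul_counitl Ha_hopf); diagram.
- drewrite (hmul_unitl Ha_hopf); diagram.
Qed.

Lemma yd_tens_unit_r (X : yd_data V) : is_yd_module Ha X -> yd_tens Ha X (yd_unit Ha) = X.
Proof.
case: X => X α β [/= ? ? ? _ _ _ _ _]; rewrite /yd_tens /=; congr YDData.
- exact: (tens_ob_unitr V_mon).
- drewrite (hcomul_counitr Ha_hopf); diagram.
- drewrite (hmul_unitr Ha_hopf); diagram.
Qed.

Lemma yd_monoidal : strict_monoidal (YD Ha).
Proof.
split=> /=.
- split=> /=.
  + by move=> X Y f [].
  + exact: yd_mor_idm.
  + exact: yd_mor_comp.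
  + by move=> X Y f [_ _ hf _ _]; exact: (comp_idl V_cat hf).
  + by move=> X Y f [_ _ hf _ _]; exact: (comp_idr V_cat hf).
  + move=> X Y Z W f g h [_ _ hf _ _] [_ _ hg _ _] [_ _ hh _ _].
    exact: (comp_assoc V_cat hf hg hh).
- exact: yd_unit_module.
- exact: yd_tens_module.
- exact: yd_mor_tens.
- by move=> X Y [hX _ _ _ _ _ _ _] [hY _ _ _ _ _ _ _]; exact: (tens_idm V_mon).
- move=> X X' X'' Y Y' Y'' f f' g g' [_ _ h1 _ _] [_ _ h2 _ _] [_ _ h3 _ _] [_ _ h4 _ _].
  exact: (tens_comp V_mon h1 h2 h3 h4).
- exact: yd_tens_assoc.
- exact: yd_tens_unit_l.
- exact: yd_tens_unit_r.
- move=> X X' Y Y' Z Z' f g h [_ _ h1 _ _] [_ _ h2 _ _] [_ _ h3 _ _].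
  exact: (tens_arr_assoc V_mon h1 h2 h3).
- by move=> X Y f [_ _ hf _ _]; exact: (tens_arr_unitl V_mon hf).
- by move=> X Y f [_ _ hf _ _]; exact: (tens_arr_unitr V_mon hf).
Qed.

(** * The braiding of Yetter-Drinfeld modules *)

Lemma yd_mor_braid (X X' : yd_data V) : is_yd_module Ha X -> is_yd_module Ha X' ->
  is_yd_morphism Ha (yd_tens Ha X X') (yd_tens Ha X' X) (yd_braid Ha X X').
Proof.
move=> mX mX'; have := yd_module_alt mX; have := yd_module_alt mX'.
rewrite /yd_compat_alt => c' c.
split; [exact: yd_tens_module|exact: yd_tens_module| | |];
  case: mX mX' => ? ? ? am _ cc _ _ [? ? ? am' _ cc' _ _]; rewrite /yd_braid /=.
- homs.
- drewrite (eq_sym am').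
  drewrite c.
  drewrite am'.
  diagram.
(* Colinearity is the compatibility of [X'] at h = x₋₁: coassociativity of the coaction turns the
   two coactions on x into a comultiplication of x₋₁. *)
- drewrite (eq_sym cc).
  drewrite c'.
  symmetry.
  drewrite (eq_sym cc).
  diagram.
Qed.

Lemma yd_braid_nat (X X' Y Y' : yd_data V) (f g : arr V) :
  is_yd_morphism Ha X X' f -> is_yd_morphism Ha Y Y' g ->
  yd_braid Ha X' Y' ∘ (f ⊠ g) = (g ⊠ f) ∘ yd_braid Ha X Y.
Proof.
case=> [[? ? ? _ _ _ _ _]] [? ? ? _ _ _ _ _] hf fa fc.
case=> [[? ? ? _ _ _ _ _]] [? ? ? _ _ _ _ _] hg ga gc.
rewrite /yd_braid.
drewrite fc.
symmetry.
drewrite ga.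
diagram.
Qed.

Lemma yd_braid_tens_l (X Y Z : yd_data V) :
  is_yd_module Ha X -> is_yd_module Ha Y -> is_yd_module Ha Z ->
  yd_braid Ha (yd_tens Ha X Y) Z =
  (yd_braid Ha X Z ⊠ yd_car Y) ∘ (yd_car X ⊠ yd_braid Ha Y Z).
Proof.
move=> [? ? ? _ _ _ _ _] [? ? ? _ _ _ _ _] [? ? ? am _ _ _ _].
rewrite /yd_braid /=.
drewrite am.
diagram.
Qed.

Lemma yd_braid_tens_r (X Y Z : yd_data V) :
  is_yd_module Ha X -> is_yd_module Ha Y -> is_yd_module Ha Z ->
  yd_braid Ha X (yd_tens Ha Y Z) =
  (yd_car Y ⊠ yd_braid Ha X Z) ∘ (yd_braid Ha X Y ⊠ yd_car Z).
Proof.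
move=> [? ? ? _ _ cc _ _] [? ? ? _ _ _ _ _] [? ? ? _ _ _ _ _].
rewrite /yd_braid /=.
drewrite cc.
diagram.
Qed.

(** * The antipode and its inverse *)

Lemma hanti_unit : S ∘ η = η.
Proof.
transitivity ((μ ∘ (H ⊠ η)) ∘ (S ∘ η)); first by rewrite (hmul_unitr Ha_hopf); planar.
transitivity (μ ∘ (S ⊠ H) ∘ (η ⊠ η)); first planar.
rewrite -(hcomul_unit Ha_hopf).
transitivity ((μ ∘ (S ⊠ H) ∘ Δ) ∘ η); first planar.
rewrite (hanti_left Ha_hopf).
transitivity (η ∘ (ϵ ∘ η)); first planar.
have hI := unit_isob V_mon; rewrite (hcounit_unit Ha_hopf); planar.
Qed.

(* Both sides equal Σ S(a₁b₁) a₂ b₂ S(b₃) S(a₃). *)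
Lemma hanti_mul : S ∘ μ = μ ∘ P H H ∘ (S ⊠ S).
Proof.
set M := μ ∘ ((S ∘ μ) ⊠ μ) ∘ (H ⊠ H ⊠ H ⊠ μ) ∘ (H ⊠ H ⊠ H ⊠ (μ ∘ (H ⊠ S)) ⊠ S)
  ∘ (H ⊠ H ⊠ H ⊠ P H (H ⊗ H)) ∘ (H ⊠ P (H ⊗ H) H ⊠ H ⊠ H)
  ∘ (((H ⊠ Δ) ∘ Δ) ⊠ ((H ⊠ Δ) ∘ Δ)).
transitivity M; rewrite /M; last first.
  drewrite (hmul_assoc Ha_hopf).
  drewrite (eq_sym (hmul_assoc Ha_hopf)) at 1.
  drewrite (eq_sym (hmul_assoc Ha_hopf)) at 1.
  drewrite (eq_sym (hcomul_coassoc Ha_hopf)).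
  drewrite (eq_sym (hcomul_coassoc Ha_hopf)).
  drewrite (eq_sym (hcomul_mul Ha_hopf)).
  drewrite (hanti_left Ha_hopf).
  drewrite (hmul_unitl Ha_hopf).
  drewrite (hcounit_mul Ha_hopf).
  drewrite (hcomul_counitl Ha_hopf).
  drewrite (hcomul_counitl Ha_hopf).
  diagram.
symmetry.
drewrite (hanti_right Ha_hopf).
drewrite (hmul_unitl Ha_hopf).
drewrite (hanti_right Ha_hopf).
drewrite (hmul_unitr Ha_hopf).
drewrite (hcomul_counitr Ha_hopf).
drewrite (hcomul_counitr Ha_hopf).
diagram.
Qed.

Section InverseAntipode.

Variables (T : arr V) (T_hom : hom H H T) (TS : T ∘ S = H) (ST : S ∘ T = H).

(** In elements h₂ T(h₁) = ε(h). Since S reverses products, applying it gives h₁ S(h₂), an antipode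
    axiom; T then removes S and fixes the unit. Likewise [hanti_inv_left] comes from S(h₁) h₂. *)
Lemma hanti_inv_right : μ ∘ (H ⊠ T) ∘ P H H ∘ Δ = η ∘ ϵ.
Proof.
transitivity ((T ∘ S) ∘ (μ ∘ (H ⊠ T) ∘ P H H ∘ Δ)); first by rewrite TS; diagram.
drewrite hanti_mul.
drewrite ST.
drewrite (hanti_right Ha_hopf).
drewrite (eq_sym hanti_unit).
drewrite TS.
diagram.
Qed.

Lemma hanti_inv_left : μ ∘ (T ⊠ H) ∘ P H H ∘ Δ = η ∘ ϵ.
Proof.
transitivity ((T ∘ S) ∘ (μ ∘ (T ⊠ H) ∘ P H H ∘ Δ)); first by rewrite TS; diagram.
drewrite hanti_mul.
drewrite ST.
drewrite (hanti_left Ha_hopf).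
drewrite (eq_sym hanti_unit).
drewrite TS.
diagram.
Qed.

Definition yd_braid_inv (X X' : yd_data V) : arr V :=
  (yd_car X ⊠ yd_act X') ∘ (P H (yd_car X) ⊠ yd_car X')
    ∘ (((T ⊠ yd_car X) ∘ yd_coact X) ⊠ yd_car X') ∘ P (yd_car X') (yd_car X).

Lemma yd_braid_inv_hom (X X' : yd_data V) : is_yd_module Ha X -> is_yd_module Ha X' ->
  hom (yd_car X' ⊗ yd_car X) (yd_car X ⊗ yd_car X') (yd_braid_inv X X').
Proof. by move=> [? ? ? _ _ _ _ _] [? ? ? _ _ _ _ _]; rewrite /yd_braid_inv; homs. Qed.

(** With h = x₋₁, what acts on the element of [X'] is T(h₂) h₁ here and h₂ T(h₁) in [yd_braid_invr];
    both collapse to the counit. *)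
Lemma yd_braid_invl (X X' : yd_data V) : is_yd_module Ha X -> is_yd_module Ha X' ->
  yd_braid_inv X X' ∘ yd_braid Ha X X' = idm (yd_car X ⊗ yd_car X').
Proof.
move=> [? ? ? _ _ cc cu _] [? ? ? am au _ _ _]; rewrite /yd_braid_inv /yd_braid.
drewrite (eq_sym am).
drewrite (eq_sym cc).
drewrite hanti_inv_left.
drewrite au.
drewrite cu.
diagram.
Qed.

Lemma yd_braid_invr (X X' : yd_data V) : is_yd_module Ha X -> is_yd_module Ha X' ->
  yd_braid Ha X X' ∘ yd_braid_inv X X' = idm (yd_car X' ⊗ yd_car X).
Proof.
move=> [? ? ? _ _ cc cu _] [? ? ? am au _ _ _]; rewrite /yd_braid_inv /yd_braid.
drewrite (eq_sym am).
drewrite (eq_sym cc).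
drewrite hanti_inv_right.
drewrite au.
drewrite cu.
diagram.
Qed.

End InverseAntipode.

Lemma yd_braided : has_invertible_antipode Ha -> strict_braided (YD Ha).
Proof.
case=> _ [T [hT [TS ST]]]; split=> /=.
- exact: yd_monoidal.
- move=> X X' mX mX'; have hb := yd_mor_braid mX mX'.
  have hi := yd_braid_inv_hom hT mX mX'.
  have el := yd_braid_invl hT TS ST mX mX'; have er := yd_braid_invr hT TS ST mX mX'.
  by split=> //; exists (yd_braid_inv T X X'); split=> //; exact: (yd_mor_inv hb).
- exact: yd_braid_nat.
- exact: yd_braid_tens_l.
- exact: yd_braid_tens_r.
Qed.

End YetterDrinfeld.

Theorem theorem4p2 (V : braided_data) (V_sym : strict_symmetric V)
    (H : hopf_data V) (H_hopf : hopf_algebra H)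
    (H_anti : has_invertible_antipode H) :
  strict_ribbon (rYD H) (rYD_duals H).
Proof. exact: (ribbon_cat_ribbon (yd_braided V_sym H_hopf H_anti)). Qed.
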